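(* Let a non-degenerate triangle have sides of lengths $a,b,c$, opposite angles $\alpha,\beta,\gamma$ respectively, and area $\Delta$. Endow the set of chords of the triangle with the invariant measure $\mu$. If the triangle has an obtuse angle, label it so that $\gamma>\pi/2$ (so $c$ is the longest side); then the density of measure of the length of the chords of the triangle is $$\rho_{\rm obt.tr}(\ell)=\rho_{\rm obt}(\ell,\alpha,\beta,\gamma,a,b,c)+\rho_{\rm obt}(\ell,\beta,\alpha,\gamma,b,a,c)+\rho_{\rm ac}(\ell,\alpha,\beta,\gamma,a,b,c).$$ Otherwise, the density of measure of the length of the chords is $$\rho_{\rm ac.tr}(\ell)=\rho_{\rm ac}(\ell,\beta,\gamma,\alpha,b,c,a)+\rho_{\rm ac}(\ell,\gamma,\alpha,\beta,c,a,b)+\rho_{\rm ac}(\ell,\alpha,\beta,\gamma,a,b,c).$$ Here $$\rho_{\rm ac}(\ell,\alpha,\beta,\gamma,a,b,c)=\frac{c^2}{4\Delta}\Big[H\big(\tfrac{2\Delta}{c}-\ell\big)\big(\gamma+\tfrac{\sin2\alpha}{2}+\tfrac{\sin 2\beta}{2}\big)$$ $$+H\big(\ell-\tfrac{2\Delta}{c}\big)H(b-\ell)\Big(\arcsin\tfrac{2\Delta}{c\ell}-\alpha+\tfrac{\sin2\alpha}{2}-\tfrac{2\Delta}{c\ell}\sqrt{1-\big(\tfrac{2\Delta}{c\ell}\big)^2}\Big)$$ $$+H\big(\ell-\tfrac{2\Delta}{c}\big)H(a-\ell)\Big(\arcsin\tfrac{2\Delta}{c\ell}-\beta+\tfrac{\sin2\beta}{2}-\tfrac{2\Delta}{c\ell}\sqrt{1-\big(\tfrac{2\Delta}{c\ell}\big)^2}\Big)\Big]$$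 and $$\rho_{\rm obt}(\ell,\alpha,\beta,\gamma,a,b,c)=\frac{a^2}{4\Delta}\Big[H(b-\ell)\big(\alpha+\tfrac{\sin2\beta}{2}+\tfrac{\sin2\gamma}{2}\big)$$ $$+H(\ell-b)H(c-\ell)\Big(\arcsin\tfrac{2\Delta}{a\ell}-\beta+\tfrac{\sin2\beta}{2}-\tfrac{2\Delta}{a\ell}\sqrt{1-\big(\tfrac{2\Delta}{a\ell}\big)^2}\Big)\Big].$$
   Context: $\mu$ is the translation- and rotation-invariant measure on straight lines of the plane, normalized as $d\mu=dp\,d\theta$, where $\theta\in[0,\pi)$ is the direction of the line and $p$ its signed distance to the origin: the measure of a set of parallel lines is its cross section, and one integrates over directions. A chord of the triangle is the intersection of the triangle with a line that meets it, and the set of chords carries the measure $\mu$ of the corresponding lines. A function $\rho$ on $(0,\infty)$ is the density of measure of the length of the chords if for every Borel set $E\subset(0,\infty)$ the $\mu$-measure of the set of chords with length in $E$ is $\int_E\rho(\ell)\,d\ell$ (so $\rho$ is determined up to null sets). $H$ is the Heaviside function: $H(x)=1$ for $x>0$ and $H(x)=0$ for $x<0$. $\arcsin$ takes values in $[-\pi/2,\pi/2]$, and a term multiplied by a vanishing Heaviside factor is taken to be $0$. When $\rho_{\rm ac}$ or $\rho_{\rm obt}$ is evaluated at permuted arguments, the angles and sides are substituted in the displayed order, and $\Delta$ remains the area of the triangle. *)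

(* Defs.v *)
From HB Require Import structures.
From mathcomp Require Import all_boot all_order all_algebra.
From mathcomp Require Import all_classical all_reals all_analysis.

Set Implicit Arguments.
Unset Strict Implicit.
Unset Printing Implicit Defensive.

Import Order.TTheory GRing.Theory Num.Theory.
Import numFieldNormedType.Exports.

Local Open Scope classical_set_scope.
Local Open Scope ring_scope.

Section PlaneGeometry.
Context {R : realType}.
Implicit Types (A B C P Q X : R * R) (S T K : set (R * R)).

(* The norm that MathComp-Analysis puts on R * R is the sup norm, so the
   Euclidean structure is written out in coordinates. *)
Definition dotp P Q : R := P.1 * Q.1 + P.2 * Q.2.

Definition vec P Q : R * R := (Q.1 - P.1, Q.2 - P.2).

Definition dist P Q : R := Num.sqrt (dotp (vec P Q) (vec P Q)).

(* The angle P Q X with apex Q, in [0, pi]. *)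
Definition angle P Q X : R :=
  acos (dotp (vec Q P) (vec Q X) / (dist Q P * dist Q X)).

Definition segment P Q : set (R * R) :=
  [set X | exists t : R, [/\ 0 <= t, t <= 1 &
     X = ((1 - t) * P.1 + t * Q.1, (1 - t) * P.2 + t * Q.2)]].

Definition triangle A B C : set (R * R) :=
  [set X | exists s t u : R, [/\ 0 <= s, 0 <= t, 0 <= u, s + t + u = 1 &
     X = (s * A.1 + t * B.1 + u * C.1, s * A.2 + t * B.2 + u * C.2)]].

Definition noncollinear A B C : Prop :=
  (vec A B).1 * (vec A C).2 - (vec A B).2 * (vec A C).1 != 0.

Definition area S : R :=
  fine ((@lebesgue_measure R \x @lebesgue_measure R)%E S).

(* The line with direction (cos th, sin th) at signed distance p from the
   origin, measured along the unit normal (- sin th, cos th).  Every line is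
   [line th p] for exactly one (th, p) with 0 <= th < pi. *)
Definition line (th p : R) : set (R * R) :=
  [set X | X.2 * cos th - X.1 * sin th = p].

Definition line_coords (LL : set (set (R * R))) : set (R * R) :=
  [set x | [/\ 0 <= x.1, x.1 < pi & LL (line x.1 x.2)]].

(* dmu = dp dth; the coordinate th comes first, so that this is the integral
   over th of the Lebesgue measure of the set of admissible p. *)
Definition line_measure (LL : set (set (R * R))) : \bar R :=
  (@lebesgue_measure R \x @lebesgue_measure R)%E (line_coords LL).

Definition has_length K (l : R) : Prop :=
  exists P Q, K = segment P Q /\ l = dist P Q.

(* The lines that cut T in a chord whose length belongs to E. *)
Definition chord_lines T (E : set R) : set (set (R * R)) :=
  [set L | L `&` T !=set0 /\ exists2 l, E l & has_length (L `&` T) l].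

(* The measurability clauses make explicit that both sides of the defining
   equation are meaningful: the library's product measure and integral are
   total functions. *)
Definition chord_length_density T (rho : R -> R) : Prop :=
  measurable_fun (`]0, +oo[ : set R) rho /\
  forall E : set R, measurable E -> E `<=` (`]0, +oo[ : set R) ->
    measurable (line_coords (chord_lines T E)) /\
    line_measure (chord_lines T E) =
      (\int[@lebesgue_measure R]_(l in E) (rho l)%:E)%E.

End PlaneGeometry.

Section Densities.
Context {R : realType}.

(* [h0] is the value at 0, which the usual definition leaves unspecified. *)
Definition heaviside (h0 x : R) : R :=
  if 0 < x then 1 else if x < 0 then 0 else h0.

(* [Num.sqrt] and [asin] are total, so a term with a vanishing Heaviside
   factor is 0, also outside of the natural domain of its other factor. *)
Definition rho_ac (h0 D l al be ga a b c : R) : R :=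
  let H := heaviside h0 in
  let s := 2 * D / (c * l) in
  c ^+ 2 / (4 * D) *
  (H (2 * D / c - l) * (ga + sin (2 * al) / 2 + sin (2 * be) / 2)
   + H (l - 2 * D / c) * H (b - l) *
     (asin s - al + sin (2 * al) / 2 - s * Num.sqrt (1 - s ^+ 2))
   + H (l - 2 * D / c) * H (a - l) *
     (asin s - be + sin (2 * be) / 2 - s * Num.sqrt (1 - s ^+ 2))).

Definition rho_obt (h0 D l al be ga a b c : R) : R :=
  let H := heaviside h0 in
  let s := 2 * D / (a * l) in
  a ^+ 2 / (4 * D) *
  (H (b - l) * (al + sin (2 * be) / 2 + sin (2 * ga) / 2)
   + H (l - b) * H (c - l) *
     (asin s - be + sin (2 * be) / 2 - s * Num.sqrt (1 - s ^+ 2))).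

End Densities.

(* Main.v *)
Require Import Defs.
From HB Require Import structures.
From mathcomp Require Import all_boot all_order all_algebra.
From mathcomp Require Import all_classical all_reals all_analysis.
From mathcomp Require Import measurable_realfun ring lra.

Import Order.TTheory GRing.Theory Num.Theory.
Import numFieldNormedType.Exports.
Local Open Scope classical_set_scope.
Local Open Scope ring_scope.

Set Implicit Arguments.
Unset Strict Implicit.
Unset Printing Implicit Defensive.

(** Fix the direction [th] of the lines.  A line at distance [p] meets the
triangle when [p] lies between the least and the greatest height of the
vertices above the origin, measured along the normal; the length of its chord
is a tent in [p], linear from 0 up to the chord through the middle vertex and
linear down to 0.  If [w] is the width of the triangle along the normal and
[K] twice its area, the tent has base [w] and top [K / w], so a set [E] of
positive lengths is hit by the [p] of a set of measure
[(w ^+ 2 / K) * mu (E `&` [set l | w * l <= K])]: both flanks are affine, and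
their inverse slopes add up to the base over the top ([tent_level]).  Integrating in [th] and exchanging the integrals by Tonelli,
the density at [l] is the integral over [th] in [0, pi[ of [w th ^+ 2 / K]
restricted to the directions with [w th * l <= K]
([line_measure_chord_lines]).  The same tent, integrated in [p] for one
direction, gives the area [K / 2] ([area_triangle]).

The width is at each [th] the projection of one side, the one for which the
height differences along the two other sides have the same sign
([side_decomposition]); the integral is thus a sum over the sides.  Rotating
the origin of the angles, which is harmless because everything has period
[pi], the lines for which the side [c] is active are those that make with it
an angle [phi] between [al] and [pi - be], and then [w = c * sin phi]
([side_integral]).  What is left is the integral of [sin ^ 2] over the part of
[[al, pi - be[] on which [sin phi <= K / (c * l)].  If [al] and [be] are at most
[pi / 2], this part consists of a piece of each of the two flanks of [sin],
whence the three terms of [rho_ac] ([rho_ac_side]); if one of the two angles is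
obtuse, [sin] is monotone on the whole range, whence the two terms of [rho_obt]
([rho_obt_side]).  The identification fails only at the finitely many lengths
at which a Heaviside factor jumps, and these do not matter for integrals nor
for measurability ([chord_length_densityP]). *)

(** * Lebesgue integrals on the line *)

Section LebesgueAffine.
Context {R : realType}.
Local Notation mu := (@lebesgue_measure R).
Implicit Types (f : R -> \bar R) (k c : R) (A : set R).

Definition affine k c (x : measurableTypeR R) : measurableTypeR R := k * x + c.

Lemma measurable_affine k c : measurable_fun [set: measurableTypeR R] (affine k c).
Proof. by apply: measurable_funD => //; exact: measurable_funM. Qed.

HB.instance Definition _ k c :=
  isMeasurableFun.Build _ _ _ _ (affine k c) (measurable_affine k c).

Lemma measurable_preimage_affine k c A : measurable A ->
  measurable (affine k c @^-1` A).
Proof. by move=> mA; rewrite -[X in measurable X]setTI; exact: measurable_affine. Qed.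

(** Lebesgue measure is determined by its values on intervals, and the preimage
of an interval under an affine map is an interval scaled by [`|k|^-1]. *)
Lemma lebesgue_measure_affine k c A : k != 0 -> measurable A ->
  mu (affine k c @^-1` A) = (`|k|^-1%:E * mu A)%E.
Proof.
move=> k0 mA.
have nk0 : 0 < `|k| by rewrite normr_gt0.
pose nu' := mscale (NngNum (ltW nk0)) (pushforward mu (affine k c)).
pose nu := nu' (measurable_affine k c).
suff /(_ _ mA) -> : forall A, measurable A -> mu A = nu A.
  by rewrite /nu /nu' /mscale muleA -EFinM /= mulVf ?gt_eqF// mul1e.
apply: lebesgue_measure_unique => //= _ [[a b]] _ <-.
rewrite /nu /nu' /mscale /= /pushforward.
case: (ltgtP k 0) (k0) => // sk _.
- have -> : affine k c @^-1` `]a, b] = `[(b - c) / k, (a - c) / k[%classic.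
    apply/seteqP; split => x /=; rewrite !in_itv/= /affine.
      by rewrite ler_ndivrMr// ltr_ndivlMr//; lra.
    by rewrite ler_ndivrMr// ltr_ndivlMr//; lra.
  rewrite !lebesgue_measure_itv/= !lte_fin ltr_ndivrMr// divfK// ltrBlDr subrK.
  by case: ifP => // ab; rewrite ?mule0// -!EFinD -EFinM; congr EFin;
    rewrite ltr0_norm//; field.
- have -> : affine k c @^-1` `]a, b] = `](a - c) / k, (b - c) / k]%classic.
    apply/seteqP; split => x /=; rewrite !in_itv/= /affine.
      by rewrite ler_pdivlMr// ltr_pdivrMr//; lra.
    by rewrite ler_pdivlMr// ltr_pdivrMr//; lra.
  rewrite !lebesgue_measure_itv/= !lte_fin ltr_pdivrMr// divfK// ltrBlDr subrK.
  by case: ifP => // ab; rewrite ?mule0// -!EFinD -EFinM; congr EFin;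
    rewrite gtr0_norm//; field.
Qed.

Lemma ge0_integral_affine k c D f : `|k| = 1 -> measurable D ->
  measurable_fun D f -> (forall x, D x -> (0 <= f x)%E) ->
  (\int[mu]_(x in D) f x = \int[mu]_(x in affine k c @^-1` D) f (k * x + c)%R)%E.
Proof.
move=> k1 mD mf f0.
have k0 : k != 0 by rewrite -normr_eq0 k1 oner_eq0.
rewrite -(ge0_integral_pushforward (measurable_affine k c))//; last first.
  by move=> x /[!inE]; exact: f0.
apply: eq_measure_integral => A mA AD.
by rewrite /= /pushforward [RHS]lebesgue_measure_affine// k1 invr1 mul1e.
Qed.

Lemma integral_itv_split f (x y z : R) : x <= y <= z ->
  measurable_fun `[x, z[ f ->
  (\int[mu]_(u in `[x, z[) f u =
   \int[mu]_(u in `[x, y[) f u + \int[mu]_(u in `[y, z[) f u)%E.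
Proof.
move=> /andP[xy yz].
rewrite (@itv_bndbnd_setU _ _ (BLeft x) (BLeft y) (BLeft z))// => mf.
rewrite integral_setU//.
rewrite disj_set2E; apply/eqP/seteqP; split => // u [] /=.
by rewrite !in_itv/= => /andP[_ h1] /andP[h2 _]; move: (lt_le_trans h1 h2); rewrite ltxx.
Qed.

(** The part of [[t, t + T[] that sticks out beyond [T] is moved back to [[0, t[]
by one period. *)
Lemma ge0_integral_periodic_shift f (T t : R) : 0 <= t <= T ->
  measurable_fun setT f -> (forall x, (0 <= f x)%E) -> (forall x, f (x + T) = f x) ->
  (\int[mu]_(x in `[0%R, T[) f x = \int[mu]_(x in `[0%R, T[) f (x + t)%R)%E.
Proof.
move=> /andP[t0 tT] mf f0 fT.
have mfS D : measurable_fun D f by exact: measurable_funTS.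
have shift s x y : (\int[mu]_(x in `[(x + s)%R, (y + s)%R[) f x =
                    \int[mu]_(x in `[x, y[) f (x + s)%R)%E.
  rewrite (@ge0_integral_affine 1 s) ?normr1//.
  have -> : affine 1 s @^-1` `[x + s, y + s[ = `[x, y[%classic.
    by apply/seteqP; split => u /=; rewrite !in_itv/= /affine mul1r lerD2r ltrD2r.
  by apply: eq_integral => u _; rewrite mul1r.
rewrite -shift add0r (@integral_itv_split f t T (T + t)) ?tT ?lerDl//.
have := shift T 0 t; rewrite add0r addrC => ->.
rewrite (@integral_itv_split f 0 t T) ?t0// addeC; congr (_ + _)%E.
by apply: eq_integral => u _; rewrite fT.
Qed.

(** The companion of the shift for triangles of the other orientation, whose
directions are swept backwards. *)
Lemma ge0_integral_periodic_reflect f (T t : R) : 0 <= t <= T ->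
  measurable_fun setT f -> (forall x, (0 <= f x)%E) -> (forall x, f (x + T) = f x) ->
  (\int[mu]_(x in `[0%R, T[) f x = \int[mu]_(x in `[0%R, T[) f (t - x)%R)%E.
Proof.
move=> tT mf f0 fT.
have mfS D : measurable_fun D f by exact: measurable_funTS.
have mg : measurable_fun setT (fun x : R => f (T - x)).
  by apply: measurableT_comp => //; apply: measurable_funB.
transitivity (\int[mu]_(x in `[0%R, T[) f (T - x)%R)%E.
  rewrite integral_itv_bndo_bndc// -integral_itv_obnd_cbnd//
    (@ge0_integral_affine (-1) T)//; last by rewrite normrN1.
  have -> : affine (-1) T @^-1` `]0, T] = `[0, T[%classic.
    by apply/seteqP; split => u /=; rewrite !in_itv/= /affine; lra.
  by apply: eq_integral => u _; congr f; ring.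
rewrite (@ge0_integral_periodic_shift (fun x : R => f (T - x)) T (T - t))//.
- apply: eq_integral => u _; congr f; ring.
- by move: tT; lra.
- by move=> x; rewrite -fT; congr f; ring.
Qed.

(** Half-open intervals are used throughout because they split without
overlap. *)
Lemma integral_itv_FTC (f F : R -> R) (x y : R) : x <= y -> continuous f ->
  (forall u : R, is_derive u (1 : R) F (f u)) ->
  (\int[mu]_(u in `[x, y[) (f u)%:E = (F y - F x)%:E)%E.
Proof.
move=> xy cf dF.
have mf : measurable_fun setT (EFin \o f).
  by apply/measurable_EFinP; exact: continuous_measurable_fun.
rewrite integral_itv_bndo_bndc; last exact: measurable_funTS.
move: xy; rewrite le_eqVlt => /predU1P[<-|xy].
  by rewrite subrr set_itv1 integral_set1.
have cF : continuous F.
  by move=> u; apply/differentiable_continuous/derivable1_diffP.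
rewrite (@continuous_FTC2 _ f F)//.
- exact: continuous_subspaceT.
- split; first by move=> u _; exact: ex_derive.
    by apply: cvg_at_right_filter; exact: cF.
  by apply: cvg_at_left_filter; exact: cF.
- by move=> u _; rewrite derive1E derive_val.
Qed.

End LebesgueAffine.

(** * Chords cut out by parallel lines *)

Section ChordGeometry.
Context {R : realType}.
Implicit Types (A B C P Q X V W : R * R) (c s p : R).

Definition cross V W : R := V.1 * W.2 - V.2 * W.1.
(** For [(c, s) = (cos th, sin th)], this is the [p] of the line of direction
[th] through [X]. *)
Definition height c s X : R := X.2 * c - X.1 * s.

Definition lo3 (x y z : R) := Num.min x (Num.min y z).
Definition hi3 (x y z : R) := Num.max x (Num.max y z).
Definition mid3 (x y z : R) := x + y + z - lo3 x y z - hi3 x y z.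

(** At the middle height the value is given separately: a flank degenerates when
the lines are parallel to a side, and its formula divides by zero then. *)
Definition tent (K lo mid hi p : R) : R :=
  if p < mid then K * (p - lo) / ((mid - lo) * (hi - lo))
  else if mid < p then K * (hi - p) / ((hi - mid) * (hi - lo))
  else K / (hi - lo).

Lemma point_eq (P Q : R * R) : P.1 = Q.1 -> P.2 = Q.2 -> P = Q.
Proof. by case: P Q => [? ?] [? ?] /= -> ->. Qed.

Lemma segment_dist_le P Q P' Q' :
  segment P' Q' `<=` segment P Q -> dist P' Q' <= dist P Q.
Proof.
move=> sub.
have [t [t0 t1 EP]] : segment P Q P'.
  by apply: sub; exists 0; split => //; apply: point_eq => /=; ring.
have [u [u0 u1 EQ]] : segment P Q Q'.
  by apply: sub; exists 1; split => //; apply: point_eq => /=; ring.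
rewrite /dist ler_wsqrtr//.
have -> : dotp (vec P' Q') (vec P' Q') = (u - t) ^+ 2 * dotp (vec P Q) (vec P Q).
  by rewrite EP EQ /dotp /vec /=; ring.
apply: ler_piMl; first by rewrite /dotp -!expr2 addr_ge0 ?sqr_ge0.
by rewrite expr2; nra.
Qed.

(** This makes the length of a chord a function of the chord, although
[has_length] only asserts the existence of endpoints. *)
Lemma segment_dist P Q P' Q' :
  segment P Q = segment P' Q' -> dist P Q = dist P' Q'.
Proof.
by move=> E; apply/eqP; rewrite eq_le !segment_dist_le// E.
Qed.

Lemma triangleCA A B C : triangle A B C = triangle B C A.
Proof.
apply/seteqP; split => X [r [t [u [r0 t0 u0 rtu ->]]]].
  by exists t, u, r; split => //; [rewrite -rtu; ring | apply: point_eq => /=; ring].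
by exists u, r, t; split => //; [rewrite -rtu; ring | apply: point_eq => /=; ring].
Qed.

Lemma triangleC A B C : triangle A B C = triangle B A C.
Proof.
apply/seteqP; split => X [r [t [u [r0 t0 u0 rtu ->]]]];
by exists t, r, u; split => //; [rewrite -rtu; ring | apply: point_eq => /=; ring].
Qed.

Definition slice A B C c s p := [set X | height c s X = p] `&` triangle A B C.

(** Below the middle height the chord joins the two sides that issue from the
lowest vertex.  Its length comes from the planar identity
[h W * V - h V * W = cross V W * (c, s)], where [h] is the height difference
along a vector, as [(c, s)] has norm 1. *)
Lemma slice_apex A B C c s p : c ^+ 2 + s ^+ 2 = 1 ->
  height c s A < height c s B -> height c s B <= height c s C ->
  height c s A <= p <= height c s B ->
  exists P Q, slice A B C c s p = segment P Q /\
   dist P Q = `|cross (vec A B) (vec A C)| * (p - height c s A)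
     / ((height c s B - height c s A) * (height c s C - height c s A)).
Proof.
move=> cs1 AB BC /andP[Ap pB].
set hV := height c s B - height c s A; set hW := height c s C - height c s A.
set k := p - height c s A.
have hV0 : 0 < hV by rewrite subr_gt0.
have hVW : hV <= hW by rewrite lerD2r.
have hW0 : 0 < hW by exact: lt_le_trans hVW.
have k0 : 0 <= k by rewrite subr_ge0.
have khV : k <= hV by rewrite lerD2r.
have hV' : hV != 0 by rewrite gt_eqF.
have hW' : hW != 0 by rewrite gt_eqF.
exists (A.1 + k / hV * (B.1 - A.1), A.2 + k / hV * (B.2 - A.2)).
exists (A.1 + k / hW * (C.1 - A.1), A.2 + k / hW * (C.2 - A.2)).
split.
- apply/seteqP; split => X.
    move=> [] /= hX [r [t [u [r0 t0 u0 rtu EX]]]].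
    have Er : r = 1 - t - u by rewrite -rtu; ring.
    have Ek : k = t * hV + u * hW.
      by rewrite /k -hX EX Er /hV /hW /height /=; ring.
    have [k0'|kN0] := eqVneq k 0.
      have [t00 u00] : t = 0 /\ u = 0.
        have tV : 0 <= t * hV by rewrite mulr_ge0// ltW.
        have uW : 0 <= u * hW by rewrite mulr_ge0// ltW.
        have /eqP : t * hV = 0 by lra.
        have /eqP : u * hW = 0 by lra.
        by rewrite !mulf_eq0 (negbTE hV') (negbTE hW') !orbF => /eqP -> /eqP ->.
      exists 0; split => //; rewrite k0' EX Er t00 u00.
      by apply: point_eq => /=; ring.
    have kP : 0 < k by rewrite lt0r kN0.
    have uW : 0 <= u * hW by rewrite mulr_ge0// ltW.
    have tV : 0 <= t * hV by rewrite mulr_ge0// ltW.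
    exists (u * hW / k); split.
    + by rewrite divr_ge0.
    + by rewrite ler_pdivrMr// mul1r Ek; lra.
    + have Et : (1 - u * hW / k) * (k / hV) = t.
        by rewrite mulrA mulrBl mul1r divfK// Ek addrK mulfK.
      have Eu : u * hW / k * (k / hW) = u.
        by rewrite mulrA divfK// mulfK.
      set l := u * hW / k in Et Eu *.
      have comb x y z : (1 - l) * (x + k / hV * y) + l * (x + k / hW * z) =
          x + t * y + u * z.
        transitivity (x + (1 - l) * (k / hV) * y + l * (k / hW) * z); first by ring.
        by rewrite Et Eu.
      by rewrite EX Er; apply: point_eq => /=; rewrite comb; ring.
- move=> [l [l0 l1 ->]]; split => /=.
    have Ep : p = height c s A + (1 - l) * (k / hV) * hV + l * (k / hW) * hW.
      by rewrite -(mulrA (1 - l)) -(mulrA l) !divfK// /k; ring.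
    transitivity (height c s A + (1 - l) * (k / hV) * (height c s B - height c s A)
      + l * (k / hW) * (height c s C - height c s A)); last by [].
    by rewrite /height /=; ring.
  exists (1 - (1 - l) * (k / hV) - l * (k / hW)), ((1 - l) * (k / hV)), (l * (k / hW)).
  have kV1 : k / hV <= 1 by rewrite ler_pdivrMr// mul1r.
  have kW1 : k / hW <= 1 by rewrite ler_pdivrMr// mul1r (le_trans khV).
  have kV0 : 0 <= k / hV by rewrite divr_ge0// ltW.
  have kW0 : 0 <= k / hW by rewrite divr_ge0// ltW.
  split.
  + by nra.
  + by rewrite mulr_ge0// subr_ge0.
  + by rewrite mulr_ge0.
  + by ring.
  + by apply: point_eq => /=; ring.
- set K := cross _ _.
  have -> : `|K| * k / (hV * hW) = `|K * k / (hV * hW)|.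
    by rewrite !normrM normfV normrM (ger0_norm k0) (gtr0_norm hV0) (gtr0_norm hW0).
  rewrite /dist -sqrtr_sqr; congr Num.sqrt.
  set PQ := vec _ _.
  have E1 : PQ.1 = - (K * k / (hV * hW)) * c.
    have -> : PQ.1 = k / (hV * hW) * (hV * (C.1 - A.1) - hW * (B.1 - A.1)).
      by rewrite /PQ /vec /=; field; apply/andP.
    have -> : hV * (C.1 - A.1) - hW * (B.1 - A.1) = - K * c.
      by rewrite /hV /hW /K /height /cross /vec /=; ring.
    by ring.
  have E2 : PQ.2 = - (K * k / (hV * hW)) * s.
    have -> : PQ.2 = k / (hV * hW) * (hV * (C.2 - A.2) - hW * (B.2 - A.2)).
      by rewrite /PQ /vec /=; field; apply/andP.
    have -> : hV * (C.2 - A.2) - hW * (B.2 - A.2) = - K * s.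
      by rewrite /hV /hW /K /height /cross /vec /=; ring.
    by ring.
  by rewrite /dotp E1 E2 -[RHS]mulr1 -cs1; ring.
Qed.

Lemma sliceN A B C c s p : slice A B C (- c) (- s) (- p) = slice A B C c s p.
Proof.
apply/seteqP; split => X [/= h T]; split => //=; move: h; rewrite /height.
  by move=> h; apply: oppr_inj; rewrite -h; ring.
by move=> <-; ring.
Qed.

(** Above the middle height the chord issues from the highest vertex, which
becomes the lowest one when the direction is reversed. *)
Lemma slice_sorted A B C c s p : c ^+ 2 + s ^+ 2 = 1 ->
  height c s A <= height c s B <= height c s C -> height c s A < height c s C ->
  height c s A <= p <= height c s C ->
  exists P Q, slice A B C c s p = segment P Q /\
   dist P Q = tent `|cross (vec A B) (vec A C)|
     (height c s A) (height c s B) (height c s C) p.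
Proof.
move=> cs1 /andP[AB BC] AC /andP[Ap pC].
have hN X : height (- c) (- s) X = - height c s X by rewrite /height; ring.
have up : height c s B < height c s C -> height c s B <= p ->
    exists P Q, slice A B C c s p = segment P Q /\
   dist P Q = `|cross (vec A B) (vec A C)| * (height c s C - p)
     / ((height c s C - height c s B) * (height c s C - height c s A)).
  move=> BC' Bp.
  have [||||P [Q [E1 E2]]] := @slice_apex C B A (- c) (- s) (- p).
  - by rewrite !sqrrN.
  - by rewrite !hN; lra.
  - by rewrite !hN; lra.
  - by rewrite !hN; lra.
  exists P, Q; split.
    by rewrite -E1 sliceN /slice (triangleCA A B C) (triangleC B C A).
  rewrite E2 !hN !opprK (addrC (- p)) (addrC (- height c s B)) (addrC (- height c s A)).
  have -> // : `|cross (vec C B) (vec C A)| = `|cross (vec A B) (vec A C)|.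
  by rewrite -normrN; congr `| _ |; rewrite /cross /vec /=; ring.
rewrite /tent; case: (ltgtP p (height c s B)) => pB.
- by apply: slice_apex => //; lra.
- by apply: up; lra.
- move: AB; rewrite le_eqVlt => /predU1P[AB|AB]; last first.
    have [||||P [Q [E1 E2]]] := @slice_apex A B C c s p => //; first by lra.
    exists P, Q; split => //; rewrite E2 pB; field.
    by rewrite !subr_eq0 !gt_eqF.
  have [||P [Q [E1 E2]]] := up; [lra|lra|].
  exists P, Q; split => //; rewrite E2 pB AB; field.
  by rewrite !subr_eq0 !gt_eqF// -AB.
Qed.

Lemma lo3_sorted (x y z : R) : x <= y <= z -> lo3 x y z = x.
Proof. by move=> /andP[xy yz]; rewrite /lo3 (min_l yz) (min_l xy). Qed.
Lemma hi3_sorted (x y z : R) : x <= y <= z -> hi3 x y z = z.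
Proof. by move=> /andP[xy yz]; rewrite /hi3 (max_r yz) (max_r (le_trans xy yz)). Qed.
Lemma mid3_sorted (x y z : R) : x <= y <= z -> mid3 x y z = y.
Proof. by move=> xyz; rewrite /mid3 lo3_sorted// hi3_sorted//; ring. Qed.

(** The conclusion of [slice_sorted] in a form invariant under permutation of the
vertices, so that they may be sorted by height ([sort3]). *)
Definition slice_spec c s A B C := forall p,
  let x := height c s A in let y := height c s B in let z := height c s C in
  lo3 x y z <= p <= hi3 x y z ->
  exists P Q, slice A B C c s p = segment P Q /\
   dist P Q = tent `|cross (vec A B) (vec A C)| (lo3 x y z) (mid3 x y z) (hi3 x y z) p.

Lemma slice_specCA c s A B C : slice_spec c s A B C -> slice_spec c s B C A.
Proof.
rewrite /slice_spec /= => H p.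
have -> : lo3 (height c s B) (height c s C) (height c s A) =
          lo3 (height c s A) (height c s B) (height c s C).
  by rewrite /lo3 [RHS]minC minA.
have -> : hi3 (height c s B) (height c s C) (height c s A) =
          hi3 (height c s A) (height c s B) (height c s C).
  by rewrite /hi3 [RHS]maxC maxA.
have -> : mid3 (height c s B) (height c s C) (height c s A) =
          mid3 (height c s A) (height c s B) (height c s C).
  rewrite /mid3 /lo3 /hi3 ![in RHS](minC (height c s A)) ![in RHS](maxC (height c s A)).
  by rewrite minA maxA; ring.
move=> /H [P [Q [E1 E2]]]; exists P, Q; split.
  by rewrite -E1 /slice -triangleCA.
by rewrite E2; congr tent; congr `| _ |; rewrite /cross /vec /=; ring.
Qed.

Lemma slice_specC c s A B C : slice_spec c s A B C -> slice_spec c s B A C.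
Proof.
rewrite /slice_spec /= => H p.
have -> : lo3 (height c s B) (height c s A) (height c s C) =
          lo3 (height c s A) (height c s B) (height c s C).
  by rewrite /lo3 minCA.
have -> : hi3 (height c s B) (height c s A) (height c s C) =
          hi3 (height c s A) (height c s B) (height c s C).
  by rewrite /hi3 maxCA.
have -> : mid3 (height c s B) (height c s A) (height c s C) =
          mid3 (height c s A) (height c s B) (height c s C).
  by rewrite /mid3 /lo3 /hi3 minCA maxCA; ring.
move=> /H [P [Q [E1 E2]]]; exists P, Q; split.
  by rewrite -E1 /slice triangleC.
rewrite E2; congr tent; rewrite -normrN; congr `| _ |.
by rewrite /cross /vec /=; ring.
Qed.

(** The vertices would otherwise lie on one line of direction [(c, s)]. *)
Lemma height_neq c s A B C : c ^+ 2 + s ^+ 2 = 1 -> cross (vec A B) (vec A C) != 0 ->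
  lo3 (height c s A) (height c s B) (height c s C) <
  hi3 (height c s A) (height c s B) (height c s C).
Proof.
move=> cs1 K0; rewrite ltNge; apply/negP => hl.
set lo := lo3 _ _ _ in hl; set hi := hi3 _ _ _ in hl.
have [hA hB hC] : [/\ lo <= height c s A <= hi, lo <= height c s B <= hi &
  lo <= height c s C <= hi].
  by rewrite /lo /hi /lo3 /hi3 !ge_min !le_max !lexx !orbT.
have EB : height c s B - height c s A = 0 by lra.
have EC : height c s C - height c s A = 0 by lra.
set K := cross _ _ in K0.
have Kc : K * c = - (height c s B - height c s A) * (C.1 - A.1)
    + (height c s C - height c s A) * (B.1 - A.1).
  by rewrite /K /height /cross /vec /=; ring.
have Ks : K * s = - (height c s B - height c s A) * (C.2 - A.2)
    + (height c s C - height c s A) * (B.2 - A.2).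
  by rewrite /K /height /cross /vec /=; ring.
move: Kc Ks; rewrite EB EC oppr0 !mul0r addr0 => /eqP + /eqP.
rewrite !mulf_eq0 (negbTE K0) /= => /eqP c0 /eqP s0.
by move: cs1; rewrite c0 s0 expr0n addr0 => /eqP; rewrite eq_sym oner_eq0.
Qed.

Lemma sort3 (h : R * R -> R) (S : R * R -> R * R -> R * R -> Prop) :
  (forall A B C, S A B C -> S B C A) -> (forall A B C, S A B C -> S B A C) ->
  (forall A B C, h A <= h B <= h C -> S A B C) -> forall A B C, S A B C.
Proof.
move=> rot swap sorted A B C.
wlog AB : A B / h A <= h B => [hwlog|].
  by case: (leP (h A) (h B)) => [/hwlog//|/ltW/hwlog/swap].
case: (leP (h B) (h C)) => BC; first by apply: sorted; rewrite AB.
case: (leP (h A) (h C)) => AC.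
  by apply/swap/rot/rot/sorted; rewrite AC ltW.
by apply/rot/sorted; rewrite AB ltW.
Qed.

Lemma slice_tent A B C c s : c ^+ 2 + s ^+ 2 = 1 ->
  cross (vec A B) (vec A C) != 0 -> slice_spec c s A B C.
Proof.
move=> cs1; move: A B C.
apply: (@sort3 (height c s) (fun A B C =>
  cross (vec A B) (vec A C) != 0 -> slice_spec c s A B C)) => A B C.
- move=> H K0; apply/slice_specCA/H; move: K0.
  by congr (_ != _); rewrite /cross /vec /=; ring.
- move=> H K0; apply/slice_specC/H; move: K0; rewrite -oppr_eq0.
  by congr (_ != _); rewrite /cross /vec /=; ring.
move=> ABC K0 p; have := height_neq cs1 K0.
rewrite /= !lo3_sorted// mid3_sorted// !hi3_sorted// => lohi pp.
exact: slice_sorted.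
Qed.

Lemma slice_range A B C c s p X : slice A B C c s p X ->
  lo3 (height c s A) (height c s B) (height c s C) <= p <=
  hi3 (height c s A) (height c s B) (height c s C).
Proof.
move=> [/= <- [r [t [u [r0 t0 u0 rtu ->]]]]].
set lo := lo3 _ _ _; set hi := hi3 _ _ _.
have [hA hB hC] : [/\ lo <= height c s A <= hi, lo <= height c s B <= hi &
  lo <= height c s C <= hi].
  by rewrite /lo /hi /lo3 /hi3 !ge_min !le_max !lexx !orbT.
have -> : height c s (r * A.1 + t * B.1 + u * C.1, r * A.2 + t * B.2 + u * C.2) =
  r * height c s A + t * height c s B + u * height c s C.
  by rewrite /height /=; ring.
have Er : r = 1 - t - u by rewrite -rtu; ring.
by rewrite Er in r0 *; nra.
Qed.

(** The geometry of chords enters the measure theory only through this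
equivalence. *)
Lemma chord_linesP A B C (E : set R) th p :
  cross (vec A B) (vec A C) != 0 ->
  let x := height (cos th) (sin th) A in
  let y := height (cos th) (sin th) B in
  let z := height (cos th) (sin th) C in
  chord_lines (triangle A B C) E (line th p) <->
  (lo3 x y z <= p <= hi3 x y z /\
   E (tent `|cross (vec A B) (vec A C)| (lo3 x y z) (mid3 x y z) (hi3 x y z) p)).
Proof.
move=> K0 x y z; have cs1 := cos2Dsin2 th.
have LE : line th p `&` triangle A B C = slice A B C (cos th) (sin th) p by [].
rewrite /chord_lines /= LE; split.
- move=> [[X hX] [l El [P [Q [E1 E2]]]]].
  have pp := slice_range hX; split => //.
  have [P' [Q' [E1' E2']]] := slice_tent cs1 K0 pp.
  by rewrite -E2' (@segment_dist _ _ P Q) -?E1' -?E2.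
- move=> [pp Et]; have [P [Q [E1 E2]]] := slice_tent cs1 K0 pp; split.
    by exists P; rewrite E1; exists 0; split => //; apply: point_eq => /=; ring.
  by exists (dist P Q); [rewrite E2 | exists P, Q].
Qed.

End ChordGeometry.

(** * Distribution of the chord length in a fixed direction *)

Section Tent.
Context {R : realType}.
Local Notation mu := (@lebesgue_measure R).
Implicit Types (E : set R) (K lo mid hi p : R).

Lemma lebesgue_measure_disjU (A B : set R) :
  measurable A -> measurable B -> A `&` B = set0 -> mu (A `|` B) = (mu A + mu B)%E.
Proof. by move=> mA mB AB; exact: measureU. Qed.

Lemma lebesgue_measure_setU1 (A : set R) x :
  measurable A -> mu (A `|` [set x]) = mu A.
Proof.
move=> mA; have [Ax|Ax] := pselect (A x); first by congr (mu _); apply/setUidl => _ ->.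
rewrite lebesgue_measure_disjU ?lebesgue_measure_set1 ?adde0//.
by apply/seteqP; split => // u [/= Au ux]; apply: Ax; rewrite -ux.
Qed.

(** A flank of horizontal extent [`|k|] that climbs to [M] spends on each set of
heights below [M] the fraction [`|k| / M] of its measure. *)
Lemma flank_measure (k x M : R) E : 0 < M -> k != 0 -> measurable E ->
  mu (affine (M / k) (- (M / k * x)) @^-1` (E `&` [set l | l < M]))
  = ((`|k| / M)%:E * mu (E `&` [set l | (l < M)%R]))%E.
Proof.
move=> M0 k0 mE.
rewrite lebesgue_measure_affine.
- by rewrite normrM normfV (gtr0_norm M0) invf_div.
- by rewrite mulf_neq0 ?invr_eq0// gt_eqF.
- apply: measurableI => //.
  by rewrite (_ : [set _ | _] = `]-oo, M[%classic).
Qed.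

(** The top of the tent is a single point of measure zero, so only the two flanks
count; each is affine, and [E] avoids the value 0 that the formulas take at the
feet of the tent. *)
Lemma tent_level K lo mid hi E : 0 < K -> lo <= mid <= hi -> lo < hi ->
  measurable E -> E `<=` `]0, +oo[ ->
  mu [set p | lo <= p <= hi /\ E (tent K lo mid hi p)] =
  (((hi - lo) ^+ 2 / K)%:E * mu (E `&` [set l | ((hi - lo) * l <= K)%R]))%E.
Proof.
move=> K0 /andP[lm mh] lh mE E0.
have w0 : 0 < hi - lo by rewrite subr_gt0.
have w0' : hi - lo != 0 by rewrite gt_eqF.
pose M := K / (hi - lo); have M0 : 0 < M by rewrite divr_gt0.
(* the top of the tent is left out: it is reached only at the middle height *)
pose E' := E `&` [set l | l < M].
have mE' : measurable E'.
  apply: measurableI => //.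
  by rewrite (_ : [set _ | _] = `]-oo, M[%classic).
have EM : mu (E `&` [set l | (hi - lo) * l <= K]) = mu E'.
  have -> : [set l | (hi - lo) * l <= K] = [set l | l < M] `|` [set M].
    apply/seteqP; split => l /=; rewrite -ler_pdivlMl// mulrC -/M.
      by rewrite le_eqVlt => /predU1P[->|]; [right|left].
    by case=> [/ltW//|->].
  rewrite setIUr; have [EM|EM] := pselect (E M).
    by rewrite [E `&` [set M]](_ : _ = [set M]) ?lebesgue_measure_setU1//;
      apply/setIidr => _ ->.
  rewrite [E `&` [set M]](_ : _ = set0) ?setU0//.
  by apply/seteqP; split => // l [/[swap] ->].
rewrite EM; set S := [set p | _].
pose S1 := S `&` [set p | p < mid]; pose S2 := S `&` [set p | mid < p].
pose S3 := S `&` [set mid].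
have S1E : measurable S1 /\ mu S1 = (((mid - lo) / M)%:E * mu E')%E.
  move: lm; rewrite le_eqVlt => /predU1P[lm|lm].
    rewrite -lm subrr mul0r mul0e; suff -> : S1 = set0 by [].
    by apply/seteqP; split => // p [/= [/andP[+ _] _]]; rewrite lm; lra.
  have k0 : mid - lo != 0 by rewrite subr_eq0 gt_eqF.
  suff -> : S1 = affine (M / (mid - lo)) (- (M / (mid - lo) * lo)) @^-1` E'.
    split; first exact: measurable_preimage_affine.
    by rewrite flank_measure// gtr0_norm// subr_gt0.
  have EA p : affine (M / (mid - lo)) (- (M / (mid - lo) * lo)) p =
      K * (p - lo) / ((mid - lo) * (hi - lo)).
    by rewrite /affine /M; field; rewrite w0'.
  have EM' p : K * (p - lo) / ((mid - lo) * (hi - lo)) = (p - lo) / (mid - lo) * M.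
    by rewrite /M; field; rewrite w0'.
  apply/seteqP; split => p.
    move=> [/= [pp Ep] pm]; rewrite /E' /= EA.
    move: Ep; rewrite /tent pm => Ep; split => //.
    by rewrite /= EM' gtr_pMl// ltr_pdivrMr ?subr_gt0// mul1r ltrD2r.
  rewrite /E' /= EA => -[Ep]; move: (E0 _ Ep).
  rewrite /= in_itv /= andbT EM' pmulr_lgt0// pmulr_lgt0 ?invr_gt0 ?subr_gt0// => p0.
  rewrite gtr_pMl// ltr_pdivrMr ?subr_gt0// mul1r ltrD2r => pm.
  by split => //=; split; [lra | rewrite /tent pm].
have S2E : measurable S2 /\ mu S2 = (((hi - mid) / M)%:E * mu E')%E.
  move: mh; rewrite le_eqVlt => /predU1P[mh|mh].
    rewrite -mh subrr mul0r mul0e; suff -> : S2 = set0 by [].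
    by apply/seteqP; split => // p [/= [/andP[_ +] _]]; rewrite mh; lra.
  have k0 : mid - hi != 0 by rewrite subr_eq0 lt_eqF.
  have k0' : hi - mid != 0 by rewrite subr_eq0 gt_eqF.
  suff -> : S2 = affine (M / (mid - hi)) (- (M / (mid - hi) * hi)) @^-1` E'.
    split; first exact: measurable_preimage_affine.
    by rewrite flank_measure// ltr0_norm ?subr_lt0// opprB.
  have EA p : affine (M / (mid - hi)) (- (M / (mid - hi) * hi)) p =
      K * (hi - p) / ((hi - mid) * (hi - lo)).
    by rewrite /affine /M; field; rewrite w0' k0 k0'.
  have EM' p : K * (hi - p) / ((hi - mid) * (hi - lo)) = (hi - p) / (hi - mid) * M.
    by rewrite /M; field; rewrite w0'.
  apply/seteqP; split => p.
    move=> [/= [pp Ep] pm]; rewrite /E' /= EA.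
    move: Ep; rewrite /tent pm ltNge (ltW pm) /= => Ep; split => //.
    by rewrite /= EM' gtr_pMl// ltr_pdivrMr ?subr_gt0// mul1r; lra.
  rewrite /E' /= EA => -[Ep]; move: (E0 _ Ep).
  rewrite /= in_itv /= andbT EM' pmulr_lgt0// pmulr_lgt0 ?invr_gt0 ?subr_gt0// => p0.
  rewrite gtr_pMl// ltr_pdivrMr ?subr_gt0// mul1r => pm.
  have {}pm : mid < p by lra.
  by split => //=; split; [lra | rewrite /tent pm ltNge (ltW pm)].
have -> : mu S = mu (S1 `|` S2).
  have mS12 : measurable (S1 `|` S2) by apply: measurableU; [case: S1E|case: S2E].
  have SE : S = (S1 `|` S2) `|` S3.
    apply/seteqP; split => [p Sp|p [[[]|[]]|[]]//].
    by case: (ltgtP p mid) => pm; [left; left|left; right|right]; split.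
  rewrite SE; have [Sm|Sm] := pselect (S mid).
    by rewrite [S3](_ : _ = [set mid]) ?lebesgue_measure_setU1//; apply/setIidr => _ ->.
  rewrite [S3](_ : _ = set0) ?setU0//.
  by apply/seteqP; split => // l [/[swap] ->].
rewrite lebesgue_measure_disjU; first last.
- apply/seteqP; split => // p [[_ /= p1] [_ /= p2]].
  by move: (lt_trans p1 p2); rewrite ltxx.
- by case: S2E.
- by case: S1E.
rewrite S1E.2 S2E.2 -ge0_muleDl ?lee_fin ?divr_ge0 ?subr_ge0 ?(ltW K0) ?(ltW lh)//.
rewrite -EFinD; congr (_%:E * _)%E.
by rewrite /M; field; rewrite w0' gt_eqF.
Qed.


(** The denominators are nonnegative, so that their inverses are powers with real
exponent [-1], including the value 0 at 0. *)
Lemma measurable_tent d (T : measurableType d) K (lo mid hi p : T -> R) :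
  measurable_fun setT lo -> measurable_fun setT mid -> measurable_fun setT hi ->
  measurable_fun setT p -> (forall t, lo t <= mid t <= hi t) ->
  measurable_fun setT (fun t => tent K (lo t) (mid t) (hi t) (p t)).
Proof.
move=> mlo mmid mhi mp lmh.
have minv (g : T -> R) : measurable_fun setT g -> (forall t, 0 <= g t) ->
    measurable_fun setT (fun t => (g t)^-1).
  move=> mg g0; rewrite (_ : (fun _ => _) = (fun t => g t `^ (-1))).
    exact: (measurableT_comp (measurable_powR (-1)) mg).
  by apply/funext => t; rewrite powR_inv1.
rewrite /tent; apply: measurable_fun_ifT; [exact: measurable_fun_ltr| |].
  apply: measurable_funM; first by apply: measurable_funM => //; exact: measurable_funB.
  apply: minv; first by apply: measurable_funM; exact: measurable_funB.
  by move=> t; have := lmh t; move=> ?; rewrite mulr_ge0 ?subr_ge0//; lra.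
apply: measurable_fun_ifT.
- exact: measurable_fun_ltr.
- apply: measurable_funM; first by apply: measurable_funM => //; exact: measurable_funB.
  apply: minv; first by apply: measurable_funM; exact: measurable_funB.
  by move=> t; have := lmh t; move=> ?; rewrite mulr_ge0 ?subr_ge0//; lra.
- apply: measurable_funM => //; apply: minv; first exact: measurable_funB.
  by move=> t; have := lmh t; move=> ?; rewrite subr_ge0//; lra.
Qed.

Lemma integral_tent K lo mid hi : 0 < K -> lo <= mid <= hi -> lo < hi ->
  (\int[mu]_(p in `[lo, hi[) (tent K lo mid hi p)%:E = (K / 2)%:E)%E.
Proof.
move=> K0 /andP[lm mh] lh.
have w0 : hi - lo != 0 by rewrite subr_eq0 gt_eqF.
have lin (k x y z : R) : y <= z -> (\int[mu]_(p in `[y, z[) (k * (p - x))%:E =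
   (k * (z - x) ^+ 2 / 2 - k * (y - x) ^+ 2 / 2)%:E)%E.
  move=> yz; 
  apply: (@integral_itv_FTC _ (fun p => k * (p - x))
    (fun p => k * (p - x) ^+ 2 / 2)) => //.
    move=> u; apply: cvgM; first exact: cvg_cst.
    by apply: cvgB; [exact: cvg_id|exact: cvg_cst].
  move=> u; apply: is_derive_eq.
  by rewrite /GRing.scale /=; field.
have mt : measurable_fun setT (fun p => tent K lo mid hi p).
  by apply: measurable_tent => // p; rewrite lm.
have mtE D : measurable_fun D (fun p => (tent K lo mid hi p)%:E).
  by apply/measurable_funTS/measurable_EFinP.
rewrite (@integral_itv_split _ _ lo mid hi)//; last by rewrite lm.
have -> : (\int[mu]_(p in `[lo, mid[) (tent K lo mid hi p)%:E =
    \int[mu]_(p in `[lo, mid[) (K / ((mid - lo) * (hi - lo)) * (p - lo))%:E)%E.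
  apply: eq_integral => p; rewrite inE /= in_itv /= => /andP[_ pm].
  by rewrite /tent pm mulrAC.
have -> : (\int[mu]_(p in `[mid, hi[) (tent K lo mid hi p)%:E =
    \int[mu]_(p in `[mid, hi[) (- (K / ((hi - mid) * (hi - lo))) * (p - hi))%:E)%E.
  apply: eq_integral => p; rewrite inE /= in_itv /= => /andP[pm ph].
  have mh0 : hi - mid != 0 by rewrite subr_eq0 gt_eqF// (le_lt_trans pm).
  rewrite /tent ltNge pm /=; case: ltP => pm'.
    by congr EFin; rewrite mulNr -mulrN opprB mulrAC.
  have -> : p = mid by apply/eqP; rewrite eq_le pm pm'.
  by congr EFin; field; rewrite mh0 w0.
rewrite !lin// -EFinD; congr EFin.
have F1 : K / ((mid - lo) * (hi - lo)) * (mid - lo) ^+ 2 = K / (hi - lo) * (mid - lo).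
  have [->|ml] := eqVneq mid lo; first by rewrite subrr expr0n /= !mulr0.
  by field; rewrite w0 subr_eq0.
have F2 : K / ((hi - mid) * (hi - lo)) * (mid - hi) ^+ 2 = K / (hi - lo) * (hi - mid).
  have [->|ml] := eqVneq hi mid; first by rewrite subrr expr0n /= !mulr0.
  by field; rewrite w0 subr_eq0.
rewrite !subrr expr0n /= !mulr0 F1 !mulNr F2; field.
exact: w0.
Qed.

End Tent.

(** * Area of a triangle *)

Section Area.
Context {R : realType}.
Local Notation mu := (@lebesgue_measure R).
Implicit Types (A B C P Q : R * R) (E : set R).

Lemma lo3_mid3_hi3 (x y z : R) : lo3 x y z <= mid3 x y z <= hi3 x y z.
Proof.
rewrite /mid3 /lo3 /hi3 !minElt !maxElt.
by case: (ltP y z) => ?; do !case: ltP => ?; lra.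
Qed.

Lemma lebesgue_measure_segment2 (x y : R) :
  mu [set u | exists t : R, [/\ 0 <= t, t <= 1 & u = (1 - t) * x + t * y]] = `|y - x|%:E.
Proof.
have E (a b : R) : a <= b ->
    [set u | exists t : R, [/\ 0 <= t, t <= 1 & u = (1 - t) * a + t * b]] = `[a, b]%classic.
  move=> ab; apply/seteqP; split => u /=; rewrite in_itv /=.
    by move=> [t [t0 t1 ->]]; nra.
  move=> /andP[au ub]; have [E|ab'] := eqVneq a b.
    by exists 0; split => //; rewrite E in au *; lra.
  have ba0 : 0 < b - a by rewrite subr_gt0 lt_neqAle ab'.
  exists ((u - a) / (b - a)); split.
  - by rewrite divr_ge0 ?subr_ge0.
  - by rewrite ler_pdivrMr// mul1r lerD2r.
  - by field; rewrite gt_eqF.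
have itvE (a b : R) : a <= b -> mu `[a, b] = (b - a)%:E.
  move=> ab; rewrite lebesgue_measure_itv /= lte_fin; case: ltP => // ba.
  by rewrite (_ : a = b) ?subrr//; apply/eqP; rewrite eq_le ab.
have [xy|/ltW yx] := leP x y.
  by rewrite E// itvE// ger0_norm// subr_ge0.
rewrite (_ : [set u | _] =
  [set u | exists t : R, [/\ 0 <= t, t <= 1 & u = (1 - t) * y + t * x]]).
  by rewrite E// itvE// ler0_norm ?subr_le0// opprB.
by apply/seteqP; split => u /= [t [t0 t1 ->]]; exists (1 - t); split; try lra.
Qed.

(** Cavalieri's principle with vertical lines: the sections of the triangle are
its chords in the direction [(0, -1)], so the area is the integral of a tent. *)
Lemma area_triangle A B C : cross (vec A B) (vec A C) != 0 ->
  area (triangle A B C) = `|cross (vec A B) (vec A C)| / 2.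
Proof.
move=> K0; set K := `|_|; have K_gt0 : 0 < K by rewrite normr_gt0.
have cs1 : 0 ^+ 2 + (-1) ^+ 2 = 1 :> R by rewrite expr0n add0r sqrrN expr1n.
pose lo := lo3 A.1 B.1 C.1; pose mid := mid3 A.1 B.1 C.1; pose hi := hi3 A.1 B.1 C.1.
have hX X : height 0 (-1) X = X.1 by rewrite /height; ring.
have lohi : lo < hi by have := height_neq cs1 K0; rewrite !hX.
rewrite /area /product_measure1 /=.
suff -> : (\int[mu]_x (mu \o xsection (triangle A B C)) x = (K / 2)%:E)%E by [].
rewrite -(@integral_tent R K lo mid hi)// ?lo3_mid3_hi3//.
rewrite integral_itv_bndo_bndc; last first.
  by apply/measurable_funTS/measurable_EFinP/measurable_tent => // p; exact: lo3_mid3_hi3.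
rewrite [RHS]integral_mkcond; apply: eq_integral => x _ /=; rewrite patchE.
case: ifPn; rewrite ?notin_setE ?inE /= in_itv /=.
  move=> xlh; have := slice_tent cs1 K0.
  move=> /(_ x); rewrite !hX => /(_ xlh) [P [Q [E1 E2]]].
  rewrite -E2.
  have [Px Qx] : P.1 = x /\ Q.1 = x.
    have : slice A B C 0 (-1) x P.
      by rewrite E1; exists 0; split => //; apply: point_eq => /=; ring.
    have : slice A B C 0 (-1) x Q.
      by rewrite E1; exists 1; split => //; apply: point_eq => /=; ring.
    by rewrite /slice /= !hX => -[-> _] [-> _].
  have -> : xsection (triangle A B C) x =
      [set u | exists t : R, [/\ 0 <= t, t <= 1 & u = (1 - t) * P.2 + t * Q.2]].
    rewrite xsectionE; apply/seteqP; split => u /=.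
      move=> Tu; have : slice A B C 0 (-1) x (x, u) by split => //=; rewrite hX.
      by rewrite E1 => -[t [t0 t1 [_ ->]]]; exists t.
    move=> [t [t0 t1 ->]].
    have : slice A B C 0 (-1) x (x, (1 - t) * P.2 + t * Q.2).
      by rewrite E1; exists t; split => //; apply: point_eq => //=; rewrite Px Qx; ring.
    by case.
  rewrite lebesgue_measure_segment2; congr EFin.
  by rewrite /dist /dotp /vec /= Px Qx subrr mul0r add0r -expr2 sqrtr_sqr.
move=> xlh; rewrite (_ : xsection _ _ = set0) ?measure0//.
rewrite xsectionE; apply/seteqP; split => // u /= Tu; apply: xlh.
have : slice A B C 0 (-1) x (x, u) by split => //=; rewrite hX.
by move=> /slice_range; rewrite !hX.
Qed.

End Area.

(** * The measure of lines as an integral over lengths *)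

Section LineMeasure.
Context {R : realType}.
Local Notation mu := (@lebesgue_measure R).
Variables (A B C : R * R).
Hypothesis K0 : cross (vec A B) (vec A C) != 0.
Implicit Types (E : set R) (th l : R).

Let K := `|cross (vec A B) (vec A C)|.
Let Kgt0 : 0 < K. Proof. by rewrite normr_gt0. Qed.

Let h X th := height (cos th) (sin th) X.
Let lo th := lo3 (h A th) (h B th) (h C th).
Let mid th := mid3 (h A th) (h B th) (h C th).
Let hi th := hi3 (h A th) (h B th) (h C th).

Definition width th := hi th - lo th.

(** The candidate density: the direction [th] contributes as long as [l] does not
exceed its longest chord [K / width th]. *)
Definition width_density l :=
  (\int[mu]_(th in `[0%R, pi[) (if width th * l <= K then width th ^+ 2 / K else 0)%:E)%E.

Lemma measurable_height X : measurable_fun setT (h X).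
Proof.
by apply: measurable_funB; apply: measurable_funM => //;
  apply: continuous_measurable_fun; [exact: continuous_cos|exact: continuous_sin].
Qed.

Let mlo : measurable_fun setT lo.
Proof.
by do 2 (apply: measurable_minr; first exact: measurable_height);
  exact: measurable_height.
Qed.
Let mhi : measurable_fun setT hi.
Proof.
by do 2 (apply: measurable_maxr; first exact: measurable_height);
  exact: measurable_height.
Qed.
Let mmid : measurable_fun setT mid.
Proof.
apply: measurable_funB => //; apply: measurable_funB => //.
by do 2 (apply: measurable_funD; last exact: measurable_height); exact: measurable_height.
Qed.
Let mwidth : measurable_fun setT width.
Proof. exact: measurable_funB. Qed.

Let lohi th : lo th < hi th.
Proof. exact: height_neq (cos2Dsin2 th) K0. Qed.

Let S E : set (R * R) := line_coords (chord_lines (triangle A B C) E).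

Let SE E : S E = [set x | (0 <= x.1 < pi) /\ (lo x.1 <= x.2 <= hi x.1 /\
  E (tent K (lo x.1) (mid x.1) (hi x.1) x.2))].
Proof.
apply/seteqP; split => -[th p] /=.
  by move=> [/= t0 tp] /chord_linesP -/(_ K0) H; split => //; rewrite t0 tp.
by move=> [/andP[t0 tp] H]; split => //=; apply/chord_linesP.
Qed.

Lemma measurable_chord_lines E : measurable E ->
  measurable (line_coords (chord_lines (triangle A B C) E)).
Proof.
move=> mE; rewrite -/(S E) SE.
have fstm (f : R -> R) : measurable_fun setT f ->
    measurable_fun setT (fun x : R * R => f x.1).
  by move=> mf; apply: measurableT_comp => //; exact: measurable_fst.
have msnd : measurable_fun setT (fun x : R * R => x.2) by exact: measurable_snd.
have mb (b : R * R -> bool) : measurable_fun setT b -> measurable [set x | b x].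
  by move=> mb; rewrite -[X in measurable X]setTI; exact: (mb measurableT [set true]).
pose F (x : R * R) := tent K (lo x.1) (mid x.1) (hi x.1) x.2.
rewrite (_ : [set x | _] = (fst @^-1` `[0, pi[%classic `&`
   ([set x | lo x.1 <= x.2 <= hi x.1] `&` F @^-1` E))); last first.
  by apply/seteqP; split => x [] /=; rewrite in_itv.
apply: measurableI.
  by rewrite -[X in measurable X]setTI; apply: measurable_fst.
apply: measurableI.
  by apply: mb; apply: measurable_and; apply: measurable_fun_ler => //; exact: fstm.
rewrite -[X in measurable X]setTI; apply: measurable_tent => //; try exact: fstm.
by move=> t; exact: lo3_mid3_hi3.
Qed.

Let I : set R := `[0, pi[%classic.

(* The integrand on the plane of pairs (direction, length) to which Tonelli's
   theorem is applied. *)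
Let f E (x : R * R) : \bar R :=
  (\1_I x.1 * \1_E x.2 *
   (if width x.1 * x.2 <= K then width x.1 ^+ 2 / K else 0))%:E.

Let f0 E x : (0 <= f E x)%E.
Proof.
rewrite lee_fin !mulr_ge0//; case: ifP => // _.
by rewrite divr_ge0 ?sqr_ge0// ltW.
Qed.

Let mf E : measurable E -> measurable_fun setT (f E).
Proof.
move=> mE; apply/measurable_EFinP.
have fstm (g : R -> R) : measurable_fun setT g ->
    measurable_fun setT (fun x : R * R => g x.1).
  by move=> mg; apply: measurableT_comp => //; exact: measurable_fst.
have sndm (g : R -> R) : measurable_fun setT g ->
    measurable_fun setT (fun x : R * R => g x.2).
  by move=> mg; apply: measurableT_comp => //; exact: measurable_snd.
apply: measurable_funM; first apply: measurable_funM.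
- by apply: (fstm \1_I); apply: measurable_indic; exact: measurable_itv.
- by apply: (sndm \1_E); exact: measurable_indic.
apply: measurable_fun_ifT => //.
  apply: measurable_fun_ler => //.
  by apply: measurable_funM; [exact: fstm|exact: (sndm id)].
by apply: measurable_funM => //; apply: measurable_funX; exact: fstm.
Qed.

Let width_densityE E l : l \in E -> (\int[mu]_th f E (th, l))%E = width_density l.
Proof.
move=> lE; rewrite /width_density [RHS]integral_mkcond; apply: eq_integral => th _.
by rewrite -/I patchE /f /= (indicE R I) (indicE R E) lE mulr1;
  case: (th \in I); rewrite ?mul1r ?mul0r.
Qed.

Lemma measurable_width_density : measurable_fun setT width_density.
Proof.
have -> : width_density = fubini_G mu (f setT).
  by apply/funext => l; rewrite -(@width_densityE setT) ?inE.
by apply: (@measurable_fun_fubini_tonelli_G _ _ _ _ _ mu (f setT)); [exact: mf|exact: f0].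
Qed.

(** For a fixed direction the measure is given by [tent_level]; it is rewritten
as an integral over lengths, and the two integrals are exchanged. *)
Lemma line_measure_chord_lines E : measurable E -> E `<=` `]0, +oo[ ->
  line_measure (chord_lines (triangle A B C) E) = (\int[mu]_(l in E) width_density l)%E.
Proof.
move=> mE E0.
transitivity (\int[mu]_th \int[mu]_l f E (th, l))%E.
  rewrite /line_measure /product_measure1 /=; apply: eq_integral => th _ /=.
  have -> : xsection (line_coords (chord_lines (triangle A B C) E)) th =
      xsection (S E) th by [].
  rewrite SE; have [thI|thI] := boolP (0 <= th < pi); last first.
    rewrite (_ : xsection _ _ = set0) ?measure0.
      rewrite integral0_eq// => l _; rewrite /f /= indicE memNset ?mul0r//.
      by rewrite /I /= in_itv /=; exact/negP.
    by rewrite xsectionE; apply/seteqP; split => // p /=; rewrite (negbTE thI) => -[].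
  have -> : xsection [set x : R * R | (0 <= x.1 < pi) /\ (lo x.1 <= x.2 <= hi x.1 /\
      E (tent K (lo x.1) (mid x.1) (hi x.1) x.2))] th =
      [set p | lo th <= p <= hi th /\ E (tent K (lo th) (mid th) (hi th) p)].
    by rewrite xsectionE; apply/seteqP; split => p /=; [case|split].
  rewrite tent_level ?lo3_mid3_hi3//.
  have mEw : measurable (E `&` [set l | (hi th - lo th) * l <= K]).
    apply: measurableI => //.
    rewrite (_ : [set l | _] = `]-oo, K / (hi th - lo th)]%classic)//.
    by apply/seteqP; split => l /=; rewrite in_itv /= ler_pdivlMr ?subr_gt0// mulrC.
  have k0 : 0 <= (hi th - lo th) ^+ 2 / K by rewrite divr_ge0 ?sqr_ge0// ltW.
  rewrite -(setIT (E `&` _)) -integral_indic// -ge0_integralZl//; last first.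
    by apply/measurable_EFinP; exact: measurable_indic.
  apply: eq_integral => l _; rewrite /f /= -EFinM; congr EFin.
  rewrite (indicE R I) mem_set /=; last by rewrite /I /= in_itv.
  rewrite indicI /=  mul1r mulrCA; congr (_ * _).
  rewrite indicE; case: ifPn => [wl|/negP wl]; first by rewrite mem_set// mulr1.
  by rewrite memNset// mulr0.
rewrite (@fubini_tonelli _ _ _ _ _ mu mu (f E)); [|exact: mf|exact: f0].
rewrite [RHS]integral_mkcond; apply: eq_integral => l _ /=; rewrite patchE.
case: ifPn => lE; first exact: width_densityE.
by rewrite integral0_eq// => th _; rewrite /f /= (indicE R E) (negbTE lE) mulr0 mul0r.
Qed.

End LineMeasure.

(** * Angles of a triangle *)

Section Angles.
Context {R : realType}.
Implicit Types (A B C P Q X V W : R * R).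

Lemma cross_rot A B C : cross (vec B C) (vec B A) = cross (vec A B) (vec A C).
Proof. by rewrite /cross /vec /=; ring. Qed.

Lemma distC P Q : dist P Q = dist Q P.
Proof. by rewrite /dist; congr Num.sqrt; rewrite /dotp /vec /=; ring. Qed.

Lemma dist_sqr P Q : dist P Q ^+ 2 = dotp (vec P Q) (vec P Q).
Proof. by rewrite /dist sqr_sqrtr// /dotp -!expr2 addr_ge0 ?sqr_ge0. Qed.

Lemma dist_gt0 A B C : cross (vec A B) (vec A C) != 0 -> 0 < dist A B.
Proof.
move=> K0; rewrite /dist sqrtr_gt0 lt0r /dotp -!expr2 addr_ge0 ?sqr_ge0// andbT.
apply: contraNneq K0 => /eqP.
rewrite paddr_eq0 ?sqr_ge0// !sqrf_eq0 => /andP[/eqP V1 /eqP V2].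
by rewrite /cross V1 V2 !mul0r subrr.
Qed.

(** By Lagrange's identity [dotp V W ^+ 2 + cross V W ^+ 2] is the product of the
squared norms, so the argument of [acos] lies strictly between -1 and 1. *)
Lemma angleP A B C : cross (vec A B) (vec A C) != 0 ->
  [/\ 0 < angle B A C < pi,
      dist A B * dist A C * cos (angle B A C) = dotp (vec A B) (vec A C) &
      dist A B * dist A C * sin (angle B A C) = `|cross (vec A B) (vec A C)|].
Proof.
move=> K0.
have c0 : 0 < dist A B := dist_gt0 K0.
have b0 : 0 < dist A C.
  apply: (@dist_gt0 _ _ B).
  by rewrite (_ : cross _ _ = - cross (vec A B) (vec A C)) ?oppr_eq0// /cross; ring.
rewrite /angle; set m := dist A B * dist A C; set d := dotp _ _; set k := cross _ _ in K0 *.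
have m0 : 0 < m by rewrite mulr_gt0.
have lagrange : d ^+ 2 + k ^+ 2 = m ^+ 2.
  by rewrite /m exprMn !dist_sqr /d /k /dotp /cross; ring.
have q2 : (d / m) ^+ 2 = 1 - (k / m) ^+ 2.
  rewrite !expr_div_n -[1](@divff _ (m ^+ 2)) ?sqrf_eq0 ?gt_eqF//.
  by rewrite -mulrBl -lagrange addrK.
have km0 : 0 < (k / m) ^+ 2 by rewrite exprn_even_gt0//= mulf_neq0// invr_eq0 gt_eqF.
have /andP[q1 q1'] : -1 < d / m < 1.
  by rewrite -ltr_norml -(@expr_lt1 _ 2%N)// real_normK ?num_real// q2; lra.
split.
- by rewrite acos_gt0 ?acos_ltpi// ?q1 ?q1' ?(ltW q1) ?(ltW q1').
- by rewrite acosK ?in_itv /= ?(ltW q1) ?(ltW q1')// mulrC divfK// gt_eqF.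
- rewrite sin_acos ?(ltW q1) ?(ltW q1')// q2 opprB addrC subrK.
  rewrite sqrtr_sqr normrM normfV (gtr0_norm m0).
  by rewrite mulrC divfK// gt_eqF.
Qed.

(** The coordinates give [cos (al + be) = - cos ga] and [sin (al + be) = sin ga];
as [sin ga] is positive, [al + be] is less than [pi], where [cos] is
injective. *)
Lemma angle_sum A B C : cross (vec A B) (vec A C) != 0 ->
  angle B A C + angle C B A + angle A C B = pi.
Proof.
move=> K0.
have K1 : cross (vec B C) (vec B A) != 0 by rewrite cross_rot.
have K2 : cross (vec C A) (vec C B) != 0 by rewrite cross_rot.
have [/andP[al0 alpi] cal sal] := angleP K0.
have [/andP[be0 bepi] cbe sbe] := angleP K1.
have [/andP[ga0 gapi] cga sga] := angleP K2.
have c0 := dist_gt0 K0; have a0 := dist_gt0 K1; have b0 := dist_gt0 K2.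
rewrite cross_rot in sbe; rewrite 2!cross_rot in sga.
rewrite (distC A C) in cal sal; rewrite (distC B A) in cbe sbe.
rewrite (distC C B) in cga sga.
set al := angle B A C in al0 alpi cal sal *; set be := angle C B A in be0 bepi cbe sbe *.
set ga := angle A C B in ga0 gapi cga sga *.
set K := `|_| in sal sbe sga.
set a := dist B C in a0 sbe cbe cga sga *; set b := dist C A in b0 sal cal cga sga *.
set c := dist A B in c0 sal cal sbe cbe *.
have cc : c ^+ 2 = dotp (vec A B) (vec A C) + dotp (vec B C) (vec B A).
  by rewrite /c dist_sqr /dotp /vec /=; ring.
have mm x : (a * b * c ^+ 2) * x = 0 -> x = 0.
  by move=> /eqP; rewrite mulf_eq0 gt_eqF ?mulr_gt0 ?exprn_gt0// => /eqP.
have sinab : sin (al + be) = sin ga.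
  apply/eqP; rewrite -subr_eq0; apply/eqP/mm; rewrite sinD.
  transitivity ((c * b * sin al) * (a * c * cos be) + (c * b * cos al) * (a * c * sin be)
    - (b * a * sin ga) * c ^+ 2).
    by ring.
  by rewrite sal cbe cal sbe sga cc; ring.
have cosab : cos (al + be) = - cos ga.
  apply/eqP; rewrite -subr_eq0; apply/eqP/mm; rewrite cosD.
  transitivity ((c * b * cos al) * (a * c * cos be) - (c * b * sin al) * (a * c * sin be)
    + (b * a * cos ga) * c ^+ 2).
    by ring.
  rewrite sal cbe cal sbe cga /c dist_sqr -expr2 /K real_normK ?num_real//.
  by rewrite /dotp /cross /vec /=; ring.
have sga0 : 0 < sin ga by rewrite sin_gt0_pi// ga0.
have abpi : al + be < pi.
  rewrite ltNge; apply/negP => ab.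
  have : 0 <= sin (al + be - pi) by apply: sin_ge0_pi; lra.
  by rewrite -[X in 0 <= sin (X - _)](addrNK pi) addrK sinB cospi sinpi; rewrite sinab; lra.
have : al + be = pi - ga.
  apply: cos_inj; rewrite ?in_itv /=; [lra|lra|].
  by rewrite cosB cospi sinpi cosab; ring.
by move=> ->; ring.
Qed.

End Angles.

(** * Contribution of each side to the density *)

Section SideDecomposition.
Context {R : realType}.
Local Notation mu := (@lebesgue_measure R).

(** If [x] and [y] are the height differences along two consecutive sides, the
third side has height difference [x + y], and it spans the width when [x] and
[y] have the same sign.  When one of them vanishes two sides have the same
projection; the asymmetric mix of strict and weak inequalities attributes this
direction to exactly one of them. *)
Definition side_term (l K x y : R) : R :=
  if ((0 < x) && (0 <= y)) || ((x < 0) && (y <= 0)) then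
    if `|x + y| * l <= K then (x + y) ^+ 2 / K else 0
  else 0.

Lemma side_termN l K x y : side_term l K (- x) (- y) = side_term l K x y.
Proof.
by rewrite /side_term !oppr_gt0 !oppr_lt0 !oppr_ge0 !oppr_le0 orbC -opprD normrN sqrrN.
Qed.

Lemma side_term_ge0 l K x y : 0 < K -> 0 <= side_term l K x y.
Proof.
move=> K0; rewrite /side_term; case: ifP => // _; case: ifP => // _.
by rewrite divr_ge0 ?sqr_ge0// ltW.
Qed.

Lemma measurable_side_term d (T : measurableType d) l K (x y : T -> R) :
  measurable_fun setT x -> measurable_fun setT y ->
  measurable_fun setT (fun t => side_term l K (x t) (y t)).
Proof.
move=> mx my; have mxy : measurable_fun setT (fun t => x t + y t) by exact: measurable_funD.
apply: measurable_fun_ifT => //.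
  by apply: measurable_or; apply: measurable_and;
    (apply: measurable_fun_ltr || apply: measurable_fun_ler).
apply: measurable_fun_ifT => //.
  apply: measurable_fun_ler => //; apply: measurable_funM => //.
  exact: measurableT_comp.
by apply: measurable_funM => //; exact: measurable_funX.
Qed.

Lemma side_decomposition l K x y z : lo3 x y z < hi3 x y z ->
  (let w := hi3 x y z - lo3 x y z in if w * l <= K then w ^+ 2 / K else 0) =
  side_term l K (z - y) (x - z) + side_term l K (x - z) (y - x)
  + side_term l K (y - x) (z - y).
Proof.
move=> lh /=; pose G w := if w * l <= K then w ^+ 2 / K else 0.
rewrite -/(G _).
have side u v : side_term l K u v =
    if ((0 < u) && (0 <= v)) || ((u < 0) && (v <= 0)) then G `|u + v| else 0.
  by rewrite /side_term /G real_normK ?num_real.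
have Gp u : 0 <= u -> G `|u| = G u by move=> u0; rewrite ger0_norm.
have Gn u : u <= 0 -> G `|u| = G (- u) by move=> u0; rewrite ler0_norm.
rewrite !side !subr_gt0 !subr_lt0 !subr_ge0 !subr_le0.
move: lh; rewrite /lo3 /hi3 !minElt !maxElt.
case: (ltgtP x y) => xy; case: (ltgtP y z) => yz; case: (ltgtP x z) => xz /=;
  rewrite ?xy ?yz ?xz ?ltxx /=; do ?case: ltP => ?; move=> lh; rewrite ?addr0 ?add0r;
  (try by exfalso; lra);
  first [ by rewrite Gp; [congr G; lra|lra] | by rewrite Gn; [congr G; lra|lra] ].
Qed.

(** [th] is the direction of the line that makes the angle [phi] with [AB], where
[t] is the direction of [AB] up to the sign [eps] and [sg] is the orientation of
the triangle.  The right-hand sides are, up to sign, [b * c * sin (phi - al)]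
and [a * c * sin (phi + be)]. *)
Lemma height_side A B C (eps sg t phi th : R) (c := dist A B) :
  sg ^+ 2 = 1 -> eps ^+ 2 = 1 ->
  vec A B = (eps * c * cos t, eps * c * sin t) ->
  cos th = cos t * cos phi - sg * (sin t * sin phi) ->
  sin th = sin t * cos phi + sg * (cos t * sin phi) ->
  let h := height (cos th) (sin th) in
  c * (h A - h C) = eps * sg * (sin phi * dotp (vec A B) (vec A C)
     - cos phi * (sg * cross (vec A B) (vec A C))) /\
  c * (h C - h B) = eps * sg * (sin phi * dotp (vec B C) (vec B A)
     + cos phi * (sg * cross (vec A B) (vec A C))).
Proof.
move=> sg1 eps1 EV Ec Es h.
have e1 : eps * (vec A B).1 = c * cos t.
  by rewrite EV /= !mulrA -expr2 eps1 mul1r.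
have e2 : eps * (vec A B).2 = c * sin t.
  by rewrite EV /= !mulrA -expr2 eps1 mul1r.
have hE X : c * h X =
     X.2 * (eps * (vec A B).1 * cos phi - sg * (eps * (vec A B).2 * sin phi))
   - X.1 * (eps * (vec A B).2 * cos phi + sg * (eps * (vec A B).1 * sin phi)).
  by rewrite e1 e2 /h /height Ec Es; ring.
have sgE u : cos phi * (sg * u) * sg = cos phi * u.
  by rewrite -[RHS]mul1r -sg1; ring.
split; rewrite mulrBr !hE.
  transitivity (eps * (sg * (sin phi * dotp (vec A B) (vec A C))
    - cos phi * (sg * cross (vec A B) (vec A C)) * sg)).
    by rewrite sgE /dotp /cross /vec /=; ring.
  by ring.
transitivity (eps * (sg * (sin phi * dotp (vec B C) (vec B A))
    + cos phi * (sg * cross (vec A B) (vec A C)) * sg)).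
  by rewrite sgE /dotp /cross /vec /=; ring.
by ring.
Qed.

(** The angle is kept in [[0, pi]], the range of one period of lines, at the price
of a sign. *)
Lemma polar_vec (V : R * R) (c : R) : 0 < c -> c ^+ 2 = dotp V V ->
  exists eps t, [/\ 0 <= t <= pi, eps ^+ 2 = 1 & V = (eps * c * cos t, eps * c * sin t)].
Proof.
move=> c0 cV.
wlog V2 : V cV / 0 <= V.2.
  move=> H; have [/H|V20] := leP 0 V.2; first exact.
  have [||eps [t [tp e1 E]]] := H (- V.1, - V.2).
  - by rewrite cV /dotp /= !mulrNN.
  - by rewrite /= oppr_ge0 ltW.
  exists (- eps), t; split => //; first by rewrite sqrrN.
  by case: E => E1 E2; apply: point_eq => /=; apply: oppr_inj; rewrite ?E1 ?E2; ring.
have V1 : -1 <= V.1 / c <= 1.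
  rewrite -ler_norml -(@expr_le1 _ 2%N)// real_normK ?num_real// expr_div_n.
  by rewrite ler_pdivrMr ?exprn_gt0// mul1r cV /dotp -!expr2 lerDl sqr_ge0.
exists 1, (acos (V.1 / c)); split.
- by case/andP: V1 => ? ?; rewrite acos_ge0 ?acos_lepi//; apply/andP.
- by rewrite expr1n.
apply: point_eq => /=; rewrite mul1r.
  by rewrite acosK ?in_itv// mulrC divfK// gt_eqF.
rewrite sin_acos// expr_div_n -[V.2]ger0_norm// -sqrtr_sqr -{1}(gtr0_norm c0) -{1}sqrtr_sqr.
rewrite -sqrtrM ?sqr_ge0//; congr Num.sqrt.
by rewrite mulrBr mulr1 mulrC divfK ?expf_neq0 ?gt_eqF// cV /dotp; ring.
Qed.

(** Up to a common sign, [x] and [y] are [a * sin (phi + be)] and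
[b * sin (phi - al)].  For [phi] in [[0, pi[] the second is nonnegative from [al]
on and the first positive up to [pi - be]; they are never both negative,
because [al + be < pi]. *)
Lemma side_term_angle A B C (l phi eps : R) (K := `|cross (vec A B) (vec A C)|)
    (al := angle B A C) (be := angle C B A) (a := dist B C) (b := dist C A) (c := dist A B)
    (x y : R) :
  cross (vec A B) (vec A C) != 0 -> eps ^+ 2 = 1 ->
  c * x = eps * (sin phi * dotp (vec B C) (vec B A) + cos phi * K) ->
  c * y = eps * (sin phi * dotp (vec A B) (vec A C) - cos phi * K) ->
  0 <= phi < pi ->
  side_term l K x y =
  if (al <= phi) && (phi < pi - be) then
    if c * sin phi * l <= K then (c * sin phi) ^+ 2 / K else 0
  else 0.
Proof.
move=> K0 eps1 Ex Ey /andP[phi0 phipi].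
have K1 : cross (vec B C) (vec B A) != 0 by rewrite cross_rot.
have [/andP[al0 alpi] cal sal] := angleP K0.
have [/andP[be0 bepi] cbe sbe] := angleP K1.
have c0 : 0 < c := dist_gt0 K0; have a0 : 0 < a := dist_gt0 K1.
have b0 : 0 < b by apply: (@dist_gt0 _ _ _ B); rewrite cross_rot.
have albe : al + be < pi.
  have := angle_sum K0; have K2 : cross (vec C A) (vec C B) != 0 by rewrite cross_rot.
  by have [/andP[ga0 _] _ _] := angleP K2; rewrite -/al -/be; lra.
rewrite -/al in al0 alpi; rewrite -/be in be0 bepi.
rewrite cross_rot -/K (distC B A) -/c -/a -/be in cbe sbe.
rewrite -/K (distC A C) -/c -/b -/al in cal sal.
have {}Ex : x = eps * (a * sin (phi + be)).
  apply: (mulfI (lt0r_neq0 c0)); rewrite Ex -cbe -sbe sinD; ring.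
have {}Ey : y = eps * (b * sin (phi - al)).
  apply: (mulfI (lt0r_neq0 c0)); rewrite Ey -cal -sal sinB; ring.
have Exy : `|x + y| = c * sin phi.
  have -> : x + y = eps * (c * sin phi).
    apply: (mulfI (lt0r_neq0 c0)); rewrite mulrDr Ex Ey.
    have -> : c * (eps * (a * sin (phi + be))) =
        eps * (sin phi * (a * c * cos be) + cos phi * (a * c * sin be)).
      by rewrite sinD; ring.
    have -> : c * (eps * (b * sin (phi - al))) =
        eps * (sin phi * (c * b * cos al) - cos phi * (c * b * sin al)).
      by rewrite sinB; ring.
    rewrite cal cbe sal sbe.
    have -> : c * (eps * (c * sin phi)) = eps * (c ^+ 2 * sin phi) by ring.
    by rewrite /c dist_sqr /dotp /vec /=; ring.
  rewrite normrM (ger0_norm (mulr_ge0 (ltW c0) _)) ?sin_ge0_pi ?phi0 ?ltW//.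
  move/eqP: eps1; rewrite sqrf_eq1 => /orP[] /eqP ->; first by rewrite normr1 mul1r.
  by rewrite normrN1 mul1r.
have -> : side_term l K x y = side_term l K (a * sin (phi + be)) (b * sin (phi - al)).
  move/eqP: eps1; rewrite sqrf_eq1 Ex Ey => /orP[] /eqP ->; first by rewrite !mul1r.
  by rewrite !mulN1r side_termN.
have Exy' : `|a * sin (phi + be) + b * sin (phi - al)| = c * sin phi.
  rewrite -Exy Ex Ey -mulrDr normrM; move/eqP: eps1.
  rewrite sqrf_eq1 => /orP[] /eqP ->; first by rewrite normr1 mul1r.
  by rewrite normrN1 mul1r.
rewrite /side_term Exy' -(real_normK (num_real (_ + _))) Exy'; congr (if _ then _ else _).
rewrite pmulr_rgt0// pmulr_rlt0// pmulr_rge0// pmulr_rle0//.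
have sinNpi u : - pi < u < 0 -> sin u < 0.
  by move=> ?; rewrite -oppr_gt0 -sinN; apply: sin_gt0_pi; lra.
have [alphi|phial] := leP al phi.
  have -> : 0 <= sin (phi - al) by apply: sin_ge0_pi; lra.
  have [pb|bp] := ltP phi (pi - be).
    have -> : 0 < sin (phi + be) by apply: sin_gt0_pi; lra.
    by [].
  have s0 : sin (phi + be) <= 0.
    by rewrite -[phi + be](subrK pi) sinDpi oppr_le0; apply: sin_ge0_pi; lra.
  rewrite ltNge s0 /=; apply/negbTE/negP => /andP[h1 h2].
  have : 0 < sin (phi - al) by apply: sin_gt0_pi; lra.
  by rewrite ltNge h2.
have s0 : sin (phi - al) < 0 by apply: sinNpi; lra.
have s1 : 0 < sin (phi + be) by apply: sin_gt0_pi; lra.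
by rewrite s1 (lt_gtF s1) leNgt s0.
Qed.

(** Changing [th] to [t + sg * phi] measures the directions from the side [AB];
the interval of integration need not be moved since the integrand has period
[pi]. *)
Lemma side_integral A B C (l : R) (K := `|cross (vec A B) (vec A C)|)
    (al := angle B A C) (be := angle C B A) (c := dist A B)
    (h := fun X th => height (cos th) (sin th) X) :
  cross (vec A B) (vec A C) != 0 ->
  (\int[mu]_(th in `[0%R, pi[)
     (side_term l K (h C th - h B th) (h A th - h C th))%:E =
   \int[mu]_(phi in `[al, (pi - be)%R[)
     (if c * sin phi * l <= K then (c * sin phi) ^+ 2 / K else 0)%:E)%E.
Proof.
move=> K0; have Kgt0 : 0 < K by rewrite normr_gt0.
pose f th := (side_term l K (h C th - h B th) (h A th - h C th))%:E.
have mf : measurable_fun setT f.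
  apply/measurable_EFinP/measurable_side_term;
    by apply: measurable_funB; exact: measurable_height.
have f0 th : (0 <= f th)%E by rewrite lee_fin side_term_ge0.
have fpi th : f (th + pi) = f th.
  have hpi X : h X (th + pi) = - h X th.
    by rewrite /h /height sinDpi cosDpi; ring.
  rewrite /f !hpi -[in RHS]side_termN; congr (side_term _ _ _ _)%:E; ring.
have c0 : 0 < c := dist_gt0 K0.
have [eps [t [tpi eps1 EV]]] := polar_vec c0 (dist_sqr A B).
have al0 : 0 < al < pi by have [] := angleP K0.
have be0 : 0 < be < pi.
  by have [|] := @angleP _ B C A; first by rewrite cross_rot.
pose g phi := (if (al <= phi) && (phi < pi - be) then
    if c * sin phi * l <= K then (c * sin phi) ^+ 2 / K else 0 else 0)%:E.
have -> : (\int[mu]_(phi in `[al, (pi - be)%R[)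
     (if c * sin phi * l <= K then (c * sin phi) ^+ 2 / K else 0)%:E =
     \int[mu]_(phi in `[0%R, pi[) g phi)%E.
  rewrite integral_mkcond [RHS]integral_mkcond; apply: eq_integral => phi _.
  rewrite !patchE /g; case: ifPn; rewrite ?notin_setE ?inE /= in_itv /=.
    move=> /andP[h1 h2]; rewrite mem_set ?h1 ?h2//=.
    by rewrite in_itv /=; lra.
  by move=> /negP/negbTE ->; case: ifP.
suff [sg [sg1 sgK Ef]] : exists sg : R, [/\ sg ^+ 2 = 1,
    sg * cross (vec A B) (vec A C) = K &
    (\int[mu]_(th in `[0%R, pi[) f th = \int[mu]_(phi in `[0%R, pi[) f (t + sg * phi)%R)%E].
  rewrite [LHS]Ef; apply: eq_integral => phi; rewrite inE /= in_itv /= => phipi.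
  have Ec : cos (t + sg * phi) = cos t * cos phi - sg * (sin t * sin phi).
    move/eqP: sg1; rewrite sqrf_eq1 => /orP[] /eqP ->; first by rewrite !mul1r cosD.
    by rewrite !mulN1r cosB opprK.
  have Es : sin (t + sg * phi) = sin t * cos phi + sg * (cos t * sin phi).
    move/eqP: sg1; rewrite sqrf_eq1 => /orP[] /eqP ->; first by rewrite !mul1r sinD.
    by rewrite !mulN1r sinB.
  have [E1 E2] := @height_side A B C eps sg t phi (t + sg * phi) sg1 eps1 EV Ec Es.
  rewrite sgK in E1 E2.
  congr EFin; apply: (@side_term_angle A B C l phi (eps * sg)) => //.
  by rewrite exprMn eps1 sg1 mulr1.
have [Kp|Kn] := ltP 0 (cross (vec A B) (vec A C)).
  exists 1; split; [by rewrite expr1n|by rewrite mul1r /K gtr0_norm|].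
  rewrite (ge0_integral_periodic_shift tpi)//.
  by apply: eq_integral => phi _; rewrite mul1r addrC.
exists (-1); split; [by rewrite sqrrN expr1n|by rewrite mulN1r /K ler0_norm|].
rewrite (ge0_integral_periodic_reflect tpi)//.
by apply: eq_integral => phi _; rewrite mulN1r.
Qed.

Lemma width_density_sides A B C (l : R) (K := `|cross (vec A B) (vec A C)|)
  (side := fun (a al be : R) => (\int[mu]_(phi in `[al, (pi - be)%R[)
     (if a * sin phi * l <= K then (a * sin phi) ^+ 2 / K else 0)%:E)%E) :
  cross (vec A B) (vec A C) != 0 ->
  width_density A B C l = (side (dist A B) (angle B A C) (angle C B A)
   + side (dist B C) (angle C B A) (angle A C B)
   + side (dist C A) (angle A C B) (angle B A C))%E.
Proof.
move=> K0; have Kgt0 : 0 < K by rewrite normr_gt0.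
have K1 : cross (vec B C) (vec B A) != 0 by rewrite cross_rot.
have K2 : cross (vec C A) (vec C B) != 0 by rewrite cross_rot.
rewrite /side -(side_integral l K0).
have := side_integral l K1; rewrite cross_rot -/K => <-.
have := side_integral l K2; rewrite 2!cross_rot -/K => <-.
have ms (x y : R -> R) : measurable_fun setT x -> measurable_fun setT y ->
    measurable_fun `[0, pi[ (fun th => (side_term l K (x th) (y th))%:E).
  by move=> mx my; apply/measurable_funTS/measurable_EFinP/measurable_side_term.
have mh X Y : measurable_fun setT (fun th : R =>
    height (cos th) (sin th) X - height (cos th) (sin th) Y).
  by apply: measurable_funB; exact: measurable_height.
rewrite -ge0_integralD//; first last.
- exact: ms.
- by move=> th _; rewrite lee_fin side_term_ge0.
- exact: ms.
- by move=> th _; rewrite lee_fin side_term_ge0.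
rewrite -ge0_integralD//; first last.
- exact: ms.
- by move=> th _; rewrite lee_fin side_term_ge0.
- by apply: emeasurable_funD; exact: ms.
- by move=> th _; rewrite adde_ge0// lee_fin side_term_ge0.
apply: eq_integral => th _; rewrite -!EFinD; congr EFin.
by rewrite -side_decomposition//; exact: height_neq (cos2Dsin2 th) K0.
Qed.

End SideDecomposition.

(** * Closed forms *)

Section ClosedForm.
Context {R : realType}.
Local Notation mu := (@lebesgue_measure R).
Implicit Types (al be ga s x y u : R).

Definition sin2_primitive (x : R) : R := (x - sin x * cos x) / 2.
Local Notation S2 := sin2_primitive.

(** The integrand of a side [c] without its factor [c ^+ 2 / K]; the length [l]
enters only through the threshold [s = K / (c * l)]. *)
Definition capped s (u : R) : \bar R := (if sin u <= s then sin u ^+ 2 else 0)%:E.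
Definition capped_integral al be s := (\int[mu]_(u in `[al, (pi - be)%R[) capped s u)%E.

Lemma measurable_sin : measurable_fun setT (@sin R).
Proof. by apply: continuous_measurable_fun; exact: continuous_sin. Qed.

Lemma measurable_capped s D : measurable_fun D (capped s).
Proof.
apply/measurable_funTS/measurable_EFinP; apply: measurable_fun_ifT => //.
  by apply: measurable_fun_ler => //; exact: measurable_sin.
by apply: measurable_funX; exact: measurable_sin.
Qed.

(** The threshold is crossed at an endpoint, where the integrands to be compared
may differ. *)
Lemma eq_integral_open (x y : R) (f g : R -> \bar R) :
  measurable_fun setT f -> measurable_fun setT g ->
  (forall u, x < u < y -> f u = g u) ->
  (\int[mu]_(u in `[x, y[) f u = \int[mu]_(u in `[x, y[) g u)%E.
Proof.
move=> mf mg fg.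
rewrite -!integral_itv_obnd_cbnd; [|exact: measurable_funTS|exact: measurable_funTS].
by apply: eq_integral => u; rewrite inE /= in_itv /= => /fg.
Qed.

Lemma capped_full s x y : x <= y -> (forall u, x < u < y -> sin u <= s) ->
  (\int[mu]_(u in `[x, y[) capped s u = (S2 y - S2 x)%:E)%E.
Proof.
move=> xy sle.
have csin2 : continuous (fun u : R => sin u ^+ 2).
  by move=> u; apply: cvgM; exact: continuous_sin.
have dS (u : R) : is_derive u (1 : R) S2 (sin u ^+ 2).
  rewrite /S2; apply: is_derive_eq.
  rewrite /GRing.scale /= !mulr0 add0r -(expr2 (cos u)) cos2sin2; by field.
rewrite -(integral_itv_FTC xy csin2 dS).
apply: eq_integral_open; first exact: measurable_capped.
  by apply/measurable_EFinP/measurable_funX; exact: measurable_sin.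
by move=> u /sle; rewrite /capped => ->.
Qed.

Lemma capped_empty s x y : (forall u, x < u < y -> s < sin u) ->
  (\int[mu]_(u in `[x, y[) capped s u = 0)%E.
Proof.
move=> slt; rewrite -[RHS](integral0 mu `[x, y[%classic).
apply: eq_integral_open => //; first exact: measurable_capped.
by move=> u /slt; rewrite /capped ltNge => /negbTE ->.
Qed.

Lemma sin_lt_asin s u : 0 <= s <= 1 -> 0 <= u <= pi / 2 -> (sin u < s) = (u < asin s).
Proof.
move=> s01 u01; have s1 : -1 <= s <= 1 by lra.
have := asin_geNpi2 s1; have := asin_lepi2 s1 => h1 h2; have p0 := @pi_gt0 R.
by rewrite -{1}(@asinK _ s) ?in_itv//= ltr_sin// in_itv /=; [lra|apply/andP].
Qed.

Lemma sin_gt_asin s u : 0 <= s <= 1 -> 0 <= u <= pi / 2 -> (s < sin u) = (asin s < u).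
Proof.
move=> s01 u01; have s1 : -1 <= s <= 1 by lra.
have := asin_geNpi2 s1; have := asin_lepi2 s1 => h1 h2; have p0 := @pi_gt0 R.
by rewrite -{1}(@asinK _ s) ?in_itv//= ltr_sin// in_itv /=; [apply/andP|lra].
Qed.

Lemma sin_piB u : sin (pi - u) = sin u :> R.
Proof. by rewrite sinB sinpi cospi; ring. Qed.

Lemma capped_inc s x y : 0 <= s -> 0 <= x <= y -> y <= pi / 2 ->
  (\int[mu]_(u in `[x, y[) capped s u =
   (if sin y <= s then S2 y - S2 x else if sin x < s then S2 (asin s) - S2 x else 0)%:E)%E.
Proof.
move=> s0 /andP[x0 xy] ypi; case: (leP (sin y) s) => ys.
  apply: capped_full => // u /andP[xu uy]; apply: le_trans ys.
  by rewrite ltW// ltr_sin ?in_itv /=; lra.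
have s01 : 0 <= s <= 1 by rewrite s0 (le_trans (ltW ys))// sin_le1.
case: (ltP (sin x) s) => xs.
  have xa : x < asin s by rewrite -sin_lt_asin//; lra.
  have ya : asin s < y by rewrite -sin_gt_asin//; lra.
  rewrite (@integral_itv_split _ _ x (asin s) y); [|lra|exact: measurable_capped].
  rewrite [X in (_ + X)%E]capped_empty ?adde0.
    apply: capped_full; first exact: ltW.
    by move=> u uu; rewrite ltW// sin_lt_asin; lra.
  by move=> u uu; rewrite sin_gt_asin; lra.
apply: capped_empty => u /andP[xu uy]; apply: le_lt_trans xs _.
by rewrite ltr_sin ?in_itv /=; lra.
Qed.

Lemma capped_reflect s al be : capped_integral al be s = capped_integral be al s.
Proof.
have c0 u : (0 <= capped s u)%E by rewrite lee_fin; case: ifP => // _; exact: sqr_ge0.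
have mc : measurable_fun setT (fun u : R => capped s (-1 * u + pi)).
  by have := measurableT_comp (@measurable_capped s setT) (measurable_affine (-1) pi).
rewrite /capped_integral (@ge0_integral_affine _ (-1) pi) ?normrN1//;
  last exact: measurable_capped.
have -> : affine (-1) pi @^-1` `[al, pi - be[ = `]be, pi - al]%classic.
  by apply/seteqP; split => u /=; rewrite !in_itv /= /affine; lra.
rewrite integral_itv_obnd_cbnd; last exact: measurable_funTS mc.
rewrite -integral_itv_bndo_bndc; last exact: measurable_funTS mc.
by apply: eq_integral => u _; rewrite /capped (_ : -1 * u + pi = pi - u) ?sin_piB//; ring.
Qed.

(** The range is cut at [pi / 2]; the decreasing flank of [sin] is reflected onto
the increasing one, with [be] in the role of [al]. *)
Lemma capped_integral_acute s al be : 0 <= s -> 0 <= al <= pi / 2 -> 0 <= be <= pi / 2 ->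
  let flank x := if 1 <= s then S2 (pi / 2) - S2 x
    else if sin x < s then S2 (asin s) - S2 x else 0 in
  capped_integral al be s = (flank al + flank be)%:E.
Proof.
move=> s0 /andP[al0 al1] /andP[be0 be1] flank.
have flankE x : 0 <= x <= pi / 2 ->
    (\int[mu]_(u in `[x, (pi / 2)%R[) capped s u = (flank x)%:E)%E.
  by move=> x01; rewrite capped_inc// sin_pihalf.
rewrite /capped_integral (@integral_itv_split _ _ al (pi / 2) (pi - be)); last 2 first.
- by lra.
- exact: measurable_capped.
rewrite flankE ?al0// EFinD; congr (_ + _)%E.
transitivity (capped_integral (pi / 2) be s); first by [].
by rewrite capped_reflect /capped_integral (_ : pi - pi / 2 = pi / 2) ?flankE ?be0//; field.
Qed.

Lemma side_integral_capped (K c l al be : R) : 0 < K -> 0 < c -> 0 < l ->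
  (\int[mu]_(u in `[al, (pi - be)%R[)
     (if c * sin u * l <= K then (c * sin u) ^+ 2 / K else 0)%:E =
   (c ^+ 2 / K)%:E * capped_integral al be (K / (c * l)))%E.
Proof.
move=> K0 c0 l0.
have cK : 0 <= c ^+ 2 / K by rewrite divr_ge0 ?sqr_ge0// ltW.
rewrite /capped_integral -ge0_integralZl//; last 2 first.
- exact: measurable_capped.
- by move=> u _; rewrite lee_fin; case: ifP => // _; exact: sqr_ge0.
apply: eq_integral => u _; rewrite /capped -EFinM; congr EFin.
rewrite ler_pdivlMr ?mulr_gt0// (_ : sin u * (c * l) = c * sin u * l); last by ring.
by case: ifP => _; rewrite ?mulr0// exprMn mulrAC.
Qed.

Lemma heaviside_pos (h0 x : R) : 0 < x -> heaviside h0 x = 1.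
Proof. by rewrite /heaviside => ->. Qed.
Lemma heaviside_neg (h0 x : R) : x < 0 -> heaviside h0 x = 0.
Proof. by move=> x0; rewrite /heaviside x0 ltNge (ltW x0). Qed.

Lemma sin_double x : sin (2 * x) / 2 = sin x * cos x :> R.
Proof. by rewrite mulr_natl sin_mulr2n -mulr_natl; field. Qed.

Lemma S2_asin s : 0 <= s <= 1 -> S2 (asin s) = (asin s - s * Num.sqrt (1 - s ^+ 2)) / 2.
Proof.
by move=> s01; have s1 : -1 <= s <= 1 by [lra]; rewrite /S2 cos_asin// asinK// in_itv.
Qed.

Lemma S2_pihalf : S2 (pi / 2) = pi / 4 :> R.
Proof. by rewrite /S2 cos_pihalf; field. Qed.

(** When the lines run along the side [b] adjacent to [c], the longest chord is
that side, so the threshold is met there exactly for [l = b]. *)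
Lemma sin_lt_threshold (K c b l x : R) : 0 < K -> 0 < c -> 0 < b -> 0 < l ->
  c * b * sin x = K -> (sin x < K / (c * l)) = (l < b).
Proof.
move=> K0 c0 b0 l0 E.
have s0 : 0 < sin x by move: K0; rewrite -E pmulr_rgt0// mulr_gt0.
rewrite ltr_pdivlMr ?mulr_gt0// -E.
rewrite (_ : sin x * (c * l) = c * sin x * l); last by ring.
by rewrite (mulrAC c b) ltr_pM2l// mulr_gt0.
Qed.

Lemma sin_le_threshold (K c b l x : R) : 0 < K -> 0 < c -> 0 < b -> 0 < l ->
  c * b * sin x = K -> (sin x <= K / (c * l)) = (l <= b).
Proof.
move=> K0 c0 b0 l0 E.
have s0 : 0 < sin x by move: K0; rewrite -E pmulr_rgt0// mulr_gt0.
rewrite ler_pdivlMr ?mulr_gt0// -E.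
rewrite (_ : sin x * (c * l) = c * sin x * l); last by ring.
by rewrite (mulrAC c b) ler_pM2l// mulr_gt0.
Qed.

(** The excluded lengths are those at which a Heaviside factor jumps.  The height
[2 * D / c] is the length at which the threshold reaches 1. *)
Lemma rho_ac_side (h0 D l al be ga a b c : R) :
  0 < D -> 0 < l -> 0 < a -> 0 < b -> 0 < c ->
  0 <= al <= pi / 2 -> 0 <= be <= pi / 2 -> al + be + ga = pi ->
  c * b * sin al = 2 * D -> a * c * sin be = 2 * D ->
  l != 2 * D / c -> l != a -> l != b ->
  ((c ^+ 2 / (2 * D))%:E * capped_integral al be (2 * D / (c * l)))%E =
  (rho_ac h0 D l al be ga a b c)%:E.
Proof.
move=> D0 l0 a0 b0 c0 al01 be01 abg Ka Kb lh la lb.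
have s0 : 0 < 2 * D / (c * l) by rewrite divr_gt0 ?mulr_gt0.
rewrite (capped_integral_acute (ltW s0))// -EFinM; congr EFin.
rewrite /rho_ac !sin_double S2_pihalf.
rewrite (sin_lt_threshold _ c0 b0 l0 Ka) ?mulr_gt0//.
rewrite (mulrC a c) in Kb; rewrite (sin_lt_threshold _ c0 a0 l0 Kb) ?mulr_gt0//.
have sE : (1 <= 2 * D / (c * l)) = (l <= 2 * D / c).
  by rewrite !ler_pdivlMr ?mulr_gt0// mul1r mulrC.
rewrite sE; set s := 2 * D / (c * l) in s0 sE *.
have ga_e : ga = pi - al - be by lra.
case: (ltgtP l (2 * D / c)) lh => // lh _.
  rewrite (heaviside_pos h0 (x := 2 * D / c - l)) ?subr_gt0//.
  rewrite (heaviside_neg h0 (x := l - 2 * D / c)) ?subr_lt0// !mul0r !addr0 mul1r /S2 ga_e.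
  by field; rewrite gt_eqF.
have s1 : s < 1 by rewrite ltNge sE -ltNge.
have SE x : S2 (asin s) - S2 x =
    (asin s - x + sin x * cos x - s * Num.sqrt (1 - s ^+ 2)) / 2.
  by rewrite S2_asin ?(ltW s0) ?(ltW s1)// /S2; field.
rewrite !SE.
rewrite (heaviside_neg h0 (x := 2 * D / c - l)) ?subr_lt0//.
rewrite (heaviside_pos h0 (x := l - 2 * D / c)) ?subr_gt0// !mul0r !add0r !mul1r.
have D0' : D != 0 by rewrite gt_eqF.
case: (ltgtP l b) lb => // lb _; case: (ltgtP l a) la => // la _.
- rewrite (heaviside_pos h0 (x := b - l)) ?subr_gt0//
    (heaviside_pos h0 (x := a - l)) ?subr_gt0//.
  by field.
- rewrite (heaviside_pos h0 (x := b - l)) ?subr_gt0//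
    (heaviside_neg h0 (x := a - l)) ?subr_lt0//.
  by field.
- rewrite (heaviside_neg h0 (x := b - l)) ?subr_lt0//
    (heaviside_pos h0 (x := a - l)) ?subr_gt0//.
  by field.
- rewrite (heaviside_neg h0 (x := b - l)) ?subr_lt0//
    (heaviside_neg h0 (x := a - l)) ?subr_lt0//.
  by field.
Qed.

(** As [ga] is obtuse, the range [[be, pi - ga[] stays on the increasing flank of
[sin]: the threshold cuts off its upper end once [l] exceeds [b], and nothing
is left once [l] exceeds [c]. *)
Lemma rho_obt_side (h0 D l al be ga a b c : R) :
  0 < D -> 0 < l -> 0 < a -> 0 < b -> 0 < c ->
  0 < be -> pi / 2 < ga < pi -> al + be + ga = pi -> 0 < al ->
  a * c * sin be = 2 * D -> a * b * sin ga = 2 * D ->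
  l != b -> l != c ->
  ((a ^+ 2 / (2 * D))%:E * capped_integral be ga (2 * D / (a * l)))%E =
  (rho_obt h0 D l al be ga a b c)%:E.
Proof.
move=> D0 l0 a0 b0 c0 be0 /andP[ga1 ga2] abg al0 Kc Kb lb lc.
have s0 : 0 < 2 * D / (a * l) by rewrite divr_gt0 ?mulr_gt0.
have D0' : D != 0 by rewrite gt_eqF.
rewrite /capped_integral capped_inc ?(ltW s0)//; [|lra|lra].
rewrite -EFinM; congr EFin; rewrite sin_piB.
rewrite (sin_lt_threshold _ a0 c0 l0 Kc) ?mulr_gt0//.
rewrite (sin_le_threshold _ a0 b0 l0 Kb) ?mulr_gt0//.
rewrite /rho_obt !sin_double; set s := 2 * D / (a * l) in s0 *.
have al_e : al = pi - be - ga by lra.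
case: (ltgtP l b) lb => // lb _.
  rewrite (heaviside_pos h0 (x := b - l)) ?subr_gt0//
    (heaviside_neg h0 (x := l - b)) ?subr_lt0//.
  rewrite !mul0r addr0 mul1r /S2 sin_piB al_e [cos (pi - ga)]cosB cospi sinpi.
  by field.
have s1 : s < 1.
  have : s < sin ga by rewrite ltNge (sin_le_threshold _ a0 b0 l0 Kb) ?mulr_gt0// -ltNge.
  by move=> h; apply: lt_le_trans h _; exact: sin_le1.
rewrite (heaviside_neg h0 (x := b - l)) ?subr_lt0//
  (heaviside_pos h0 (x := l - b)) ?subr_gt0//.
rewrite mul0r add0r mul1r.
case: (ltgtP l c) lc => // lc _.
  rewrite (heaviside_pos h0 (x := c - l)) ?subr_gt0// S2_asin ?(ltW s0) ?(ltW s1)// /S2.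
  by field.
rewrite (heaviside_neg h0 (x := c - l)) ?subr_lt0//.
by field.
Qed.

End ClosedForm.

(** * The density of the chord length *)

Section DensityUpToFiniteSets.
Context {R : realType}.
Local Notation mu := (@lebesgue_measure R).

Lemma measurable_fun_off_finite (D F : set R) (f g : R -> R) :
  measurable D -> finite_set F -> measurable_fun D g ->
  (forall x, D x -> ~ F x -> f x = g x) -> measurable_fun D f.
Proof.
move=> mD finF mg fg.
have mfin (S : set R) : finite_set S -> measurable S.
  by move=> finS; apply: countable_measurable => //; exact: finite_set_countable.
have mF := mfin _ finF.
rewrite -(setUIDK D F) measurable_funU; [|exact: measurableI|exact: measurableD].
split.
  move=> _ Y mY; apply: mfin; apply: sub_finite_set finF => x [[]].
  by [].
apply: (@eq_measurable_fun _ _ _ _ _ g).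
  by move=> x; rewrite inE => -[Dx Fx]; rewrite fg.
by apply: measurable_funS mg => //; exact: subDsetl.
Qed.

(** Measurability of [rho] is inherited from [width_density] as well, so the
values of [asin] outside [[-1, 1]] never have to be examined. *)
Lemma chord_length_densityP (A B C : R * R) (F : set R) (rho : R -> R) :
  cross (vec A B) (vec A C) != 0 -> finite_set F ->
  (forall l, 0 < l -> ~ F l -> width_density A B C l = (rho l)%:E) ->
  chord_length_density (triangle A B C) rho.
Proof.
move=> K0 finF rhoE; have mrho : measurable_fun (`]0, +oo[ : set R) rho.
  apply: (@measurable_fun_off_finite _ F _ (fun l => fine (width_density A B C l))) => //.
    apply: measurable_funTS.
    exact: measurableT_comp (fine_measurable measurableT) (measurable_width_density K0).
  by move=> x; rewrite /= in_itv /= andbT => x0 Fx; rewrite rhoE.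
split => // E mE E0; split; first exact: measurable_chord_lines.
rewrite line_measure_chord_lines//; apply: ae_eq_integral => //.
- exact: measurable_funTS (measurable_width_density K0).
- by apply/measurable_EFinP; exact: measurable_funS mrho.
exists F; split.
- by apply: countable_measurable => //; exact: finite_set_countable.
- by apply: countable_lebesgue_measure0; exact: finite_set_countable.
move=> l /= /not_implyP[El rl]; apply: contrapT => Fl; apply: rl.
by apply: rhoE => //; have := E0 _ El; rewrite /= in_itv /= andbT.
Qed.

End DensityUpToFiniteSets.

Unset Implicit Arguments.
Set Strict Implicit.

Theorem proposition2p1 (R : realType) (h0 : R) (A B C : R * R)
    (a b c al be ga D : R)
    (ABC : noncollinear A B C)
    (ha : a = dist B C) (hb : b = dist C A) (hc : c = dist A B)
    (hal : al = angle B A C) (hbe : be = angle C B A) (hga : ga = angle A C B)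
    (hD : D = area (triangle A B C)) :
  (pi / 2 < ga ->
   chord_length_density (triangle A B C)
     (fun l => rho_obt h0 D l al be ga a b c
             + rho_obt h0 D l be al ga b a c
             + rho_ac h0 D l al be ga a b c)) /\
  (al <= pi / 2 -> be <= pi / 2 -> ga <= pi / 2 ->
   chord_length_density (triangle A B C)
     (fun l => rho_ac h0 D l be ga al b c a
             + rho_ac h0 D l ga al be c a b
             + rho_ac h0 D l al be ga a b c)).
Proof.
have K0 : cross (vec A B) (vec A C) != 0 := ABC.
have K1 : cross (vec B C) (vec B A) != 0 by rewrite cross_rot.
have K2 : cross (vec C A) (vec C B) != 0 by rewrite cross_rot.
have KD : `|cross (vec A B) (vec A C)| = 2 * D.
  by rewrite hD area_triangle// mulrC divfK.
have D0 : 0 < D by rewrite -(pmulr_rgt0 _ (ltr0Sn R 1)) -KD normr_gt0.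
have [/andP[al0 alpi] _ sal] := angleP K0.
have [/andP[be0 bepi] _ sbe] := angleP K1.
have [/andP[ga0 gapi] _ sga] := angleP K2.
have abg := angle_sum K0.
have c0 := dist_gt0 K0; have a0 := dist_gt0 K1; have b0 := dist_gt0 K2.
rewrite cross_rot in sbe; rewrite 2!cross_rot in sga.
rewrite (distC A C) in sal; rewrite (distC B A) in sbe; rewrite (distC C B) in sga.
have W l : 0 < l -> width_density A B C l =
   ((c ^+ 2 / (2 * D))%:E * capped_integral al be (2 * D / (c * l))
   + (a ^+ 2 / (2 * D))%:E * capped_integral be ga (2 * D / (a * l))
   + (b ^+ 2 / (2 * D))%:E * capped_integral ga al (2 * D / (b * l)))%E.
  move=> l0; rewrite width_density_sides// KD ha hb hc hal hbe hga.
  by rewrite !side_integral_capped// mulr_gt0.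
rewrite -hal -hc -hb KD in al0 alpi sal abg c0 b0.
rewrite -hbe -ha -hc KD in be0 bepi sbe abg a0.
rewrite -hga -ha -hb KD in ga0 gapi sga abg.
(* the lengths at which one of the Heaviside factors jumps *)
pose F := [set` [:: a; b; c; 2 * D / a; 2 * D / b; 2 * D / c]].
have finF : finite_set F by exact: finite_seq.
have FE l : ~ F l -> [/\ [/\ l != a, l != b & l != c],
    l != 2 * D / a, l != 2 * D / b & l != 2 * D / c].
  by rewrite /F /= !inE => /negP; rewrite !negb_or => /and5P[-> -> -> -> /andP[-> ->]].
have sal' : b * c * sin al = 2 * D by rewrite (mulrC b).
have sbe' : c * a * sin be = 2 * D by rewrite (mulrC c).
have sga' : a * b * sin ga = 2 * D by rewrite (mulrC a).
split=> [gaO|alA beA gaA]; apply: (chord_length_densityP K0 finF) => l l0 /FE;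
  move=> [[la lb lc] lha lhb lhc]; rewrite W//.
  (* the side CA is read from its acute end, as in [rho_obt] *)
  rewrite (capped_reflect _ ga al) (@rho_ac_side _ h0 D l al be ga a b c)//; [|lra|lra].
  rewrite (@rho_obt_side _ h0 D l al be ga a b c)//; [|lra].
  rewrite (@rho_obt_side _ h0 D l be al ga b a c)//; [|lra|lra].
  by rewrite -!EFinD; congr EFin; ring.
rewrite (@rho_ac_side _ h0 D l al be ga a b c)//; [|lra|lra].
rewrite (@rho_ac_side _ h0 D l be ga al b c a)//; [|lra|lra|lra].
rewrite (@rho_ac_side _ h0 D l ga al be c a b)//; [|lra|lra|lra].
by rewrite -!EFinD; congr EFin; ring.
Qed.
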